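(* Let $n\ge2$. The union $\widehat{\mathcal{M}}=\mathcal{M}\sqcup L_\infty$, with complex structure defined by the two charts described in the context, is a well defined Hausdorff complex manifold. Furthermore, the coordinate function $X$ extends to a locally trivial holomorphic projection $$X:\widehat{\mathcal{M}}\longrightarrow\widehat{\mathbb{C}},$$ where each fiber $L_{X_0}$ (the preimage of $X_0\in\widehat{\mathbb{C}}$) is conformally isomorphic to $\mathbb{C}$.
   Context: A rational map $f:\widehat{\mathbb{C}}\to\widehat{\mathbb{C}}$ of degree $n\ge2$ is bicritical if it has exactly two critical points. $\mathcal{M}$ denotes the set of conjugacy classes $(f)$ of degree $n$ bicritical maps under Möbius conjugation. Every bicritical map is conjugate to one of the form $f(z)=(az^n+b)/(cz^n+d)$ with $ad-bc\ne0$; the quantities $X=bc/(ad-bc)$ and $Y=\big(a^{n+1}b^{n-1}+c^{n-1}d^{n+1}\big)/(ad-bc)^n$ depend only on $(f)$, and $(X,Y)$ identifies $\mathcal{M}$ with $\mathbb{C}^2$. Let $\lambda_1,\dots,\lambda_{n+1}$ be the multipliers at the $n+1$ fixed points of $f$ (counted with multiplicity) and $\sigma_k$ their $k$-th elementary symmetric function. Then $\sigma_{n+1}=n^{n+1}X^{n-1}$, and $(X,\sigma_n)$ is also a global holomorphic coordinate system identifying $\mathcal{M}$ with $\mathbb{C}^2$. Put $L_0=\{(f)\in\mathcal{M}: X(f)=0\}$. The extended moduli space is the disjoint union $\widehat{\mathcal{M}}=\mathcal{M}\sqcup L_\infty$, where $L_\infty$ is a copy of $\mathbb{C}$ with coordinate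 $\hat\sigma_1$. It is covered by two charts, each with image $\mathbb{C}^2$: the chart $\mathcal{M}$ with coordinates $(X,\sigma_n)$, and the chart $(\mathcal{M}\smallsetminus L_0)\cup L_\infty$ with coordinates $(\hat X,\hat\sigma_1)$, where $\hat X=0$ on $L_\infty$, and on the overlap $\mathcal{M}\smallsetminus L_0$ one has $\hat X=1/X$ and $\hat\sigma_1=\sigma_n/(n^{n+1}X^{n-1})$. The extension of $X$ takes the value $\infty$ on $L_\infty$. *)

(* Defs.v *)
From HB Require Import structures.
From mathcomp Require Import all_boot all_order all_algebra.
From mathcomp Require Import all_classical all_reals topology normedtype derive.
From mathcomp Require Import complex.

Set Implicit Arguments.
Unset Strict Implicit.
Unset Printing Implicit Defensive.
Import Order.TTheory GRing.Theory Num.Theory.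
Import numFieldNormedType.Exports.
Local Open Scope classical_set_scope.
Local Open Scope ring_scope.

Record chart (E T : Type) := Chart { cdom : set T ; cmap :> T -> E }.

Definition atlas (E T : Type) := set (chart E T).

(* The set [T] with the topology determined by the atlas [A]: [V] is open when
   its trace on the domain of each chart is the preimage of an open set of the
   model space. *)
Definition charted (E T : Type) (A : atlas E T) : Type := T.

Section ChartedTopology.
Variables (E : topologicalType) (T : Type) (A : atlas E T).

Definition atlas_open (V : set T) : Prop :=
  forall c, A c -> exists2 W : set E, open W & cdom c `&` V = cdom c `&` c @^-1` W.

Lemma atlas_openT : atlas_open setT.
Proof. by move=> c _; exists setT; [exact: openT|]. Qed.

Lemma atlas_openI : setI_closed atlas_open.
Proof.
move=> V V' oV oV' c Ac.
have [W oW eW] := oV c Ac; have [W' oW' eW'] := oV' c Ac.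
exists (W `&` W'); first exact: openI.
by rewrite preimage_setI setIIr eW eW' -setIIr.
Qed.

Lemma atlas_open_bigU (I : Type) (V : I -> set T) :
  (forall i, atlas_open (V i)) -> atlas_open (\bigcup_i V i).
Proof.
move=> oV c Ac.
have /choice[W hW] : forall i, exists W : set E,
    open W /\ cdom c `&` V i = cdom c `&` c @^-1` W.
  by move=> i; have [W oW eW] := oV i c Ac; exists W.
exists (\bigcup_i W i); first by apply: bigcup_open => i _; have [] := hW i.
rewrite preimage_bigcup !setI_bigcupr.
by apply: eq_bigcupr => i _; have [] := hW i.
Qed.

HB.instance Definition _ := gen_eqMixin (charted A).
HB.instance Definition _ := gen_choiceMixin (charted A).
HB.instance Definition _ := isOpenTopological.Build (charted A)
  atlas_openT atlas_openI atlas_open_bigU.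

End ChartedTopology.

Section Manifold.
Variable K : numFieldType.

(* [psi] is a holomorphic function of [phi] over [D]; it is only used where
   [phi @` D] is open. *)
Definition holomorphic_wrt (E E' : normedModType K) (T : Type) (D : set T)
    (phi : T -> E) (psi : T -> E') : Prop :=
  exists g : E -> E',
    forall x, D x -> differentiable g (phi x) /\ g (phi x) = psi x.

Record complex_manifold (E : normedModType K) (T : topologicalType)
    (A : atlas E T) : Prop := ComplexManifold {
  chart_cover : forall x, exists2 c, A c & cdom c x ;
  chart_dom_open : forall c, A c -> open (cdom c) ;
  chart_inj : forall c, A c -> set_inj (cdom c) c ;
  chart_continuous : forall c, A c -> {within cdom c, continuous c} ;
  chart_open : forall c, A c ->
    forall V, V `<=` cdom c -> open V -> open (c @` V) ;
  chart_compatible : forall c d, A c -> A d ->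
    holomorphic_wrt (cdom c `&` cdom d) c d }.

Definition holomorphic_on (E E' : normedModType K) (T T' : topologicalType)
    (A : atlas E T) (B : atlas E' T') (D : set T) (F : T -> T') : Prop :=
  [/\ open D, {within D, continuous F} &
    forall c d, A c -> B d ->
      holomorphic_wrt (D `&` cdom c `&` F @^-1` cdom d) c (d \o F)].

Definition prod_chart (E E' : Type) (T T' : Type) (c : chart E T)
    (d : chart E' T') : chart (E * E') (T * T') :=
  Chart (cdom c `*` cdom d) (fun x => (c x.1, d x.2)).

Definition prod_atlas (E E' : Type) (T T' : Type) (A : atlas E T)
    (B : atlas E' T') : atlas (E * E') (T * T') :=
  [set e | exists c d, [/\ A c, B d & e = prod_chart c d]].

Definition model_atlas (E : Type) : atlas E E := [set Chart setT id].

(* [p] is a holomorphic fibre bundle projection with typical fibre [F]. *)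
Definition locally_trivial (E E' E'' : normedModType K)
    (T T' F : topologicalType) (A : atlas E T) (B : atlas E' T')
    (C : atlas E'' F) (p : T -> T') : Prop :=
  forall b, exists U : set T', [/\ open U, U b &
    exists (Phi : T -> T' * F) (Psi : T' * F -> T),
    [/\ holomorphic_on A (prod_atlas B C) (p @^-1` U) Phi,
        holomorphic_on (prod_atlas B C) A (U `*` setT) Psi,
        forall x, U (p x) -> (Phi x).1 = p x /\ Psi (Phi x) = x &
        forall y, U y.1 -> p (Psi y) = y.1 /\ Phi (Psi y) = y]].

(* Functions on a complex submanifold are holomorphic when they locally
   extend to holomorphic functions on the ambient manifold. *)
Definition holomorphic_on_sub (E E' : normedModType K)
    (T T' : topologicalType) (A : atlas E T) (B : atlas E' T')
    (S : set T) (r : T -> T') : Prop :=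
  forall x, S x -> exists W g,
    [/\ W x, holomorphic_on A B W g & forall y, W y -> S y -> g y = r y].

Definition sub_biholomorphic (E E' : normedModType K)
    (T T' : topologicalType) (A : atlas E T) (B : atlas E' T')
    (S : set T) : Prop :=
  exists (e : T' -> T) (r : T -> T'),
  [/\ holomorphic_on B A setT e, range e = S,
      holomorphic_on_sub A B S r & cancel e r].

End Manifold.

Definition Cx (R : realType) : numClosedFieldType := R[i].

Section Bicritical.
Variable R : realType.
Local Notation C := (Cx R).

Definition sphere_pt : Type := option C.

(* The coordinate used near [p]: [z] if [p] is finite and [1/z] at infinity
   (with value 0 at the point outside the domain of the coordinate). *)
Definition local_coord (p x : sphere_pt) : C :=
  match p, x with
  | Some _, Some z => z
  | None, Some z => z^-1
  | _, None => 0
  end.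

Definition local_param (p : sphere_pt) (w : C) : sphere_pt :=
  if p is Some _ then Some w else if w == 0 then None else Some w^-1.

Definition sphere_atlas : atlas C sphere_pt :=
  [set Chart [set x | x <> None] (local_coord (Some 0));
       Chart [set x | x <> Some 0] (local_coord None)].

Definition sphere := charted sphere_atlas.

Record ratmap (n : nat) := Ratmap {
  rnum : {poly C} ;
  rden : {poly C} ;
  rcoprime : coprimep rnum rden ;
  rdegree : maxn (size rnum) (size rden) = n.+1 }.

Definition reval n (f : ratmap n) (x : sphere_pt) : sphere_pt :=
  match x with
  | Some z => if (rden f).[z] == 0 then None
              else Some ((rnum f).[z] / (rden f).[z])
  | None => if (rden f)`_n == 0 then None
            else Some ((rnum f)`_n / (rden f)`_n)
  end.

(* Derivative in the coordinates above; at a fixed point, where source and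
   target coordinates agree, this is the multiplier. *)
Definition local_deriv (f : sphere_pt -> sphere_pt) (p : sphere_pt) : C :=
  derive1 (fun w => local_coord (f p) (f (local_param p w))) (local_coord p p).

Definition critical_points n (f : ratmap n) : set sphere_pt :=
  [set p | local_deriv (reval f) p = 0].

Definition bicritical n : set (ratmap n) :=
  [set f | exists c1 c2, c1 <> c2 /\ critical_points f = [set c1; c2]].

(* The fixed points with multiplicity: finite ones are the roots of
   [rnum f - 'X * rden f], of formal degree [n.+1], and infinity accounts for
   the drop of degree. *)
Definition fixed_points n (f : ratmap n) : seq sphere_pt :=
  let s := sval (closed_field_poly_normal (rnum f - 'X * rden f)) in
  map Some s ++ nseq (n.+1 - size s) None.

Definition multipliers n (f : ratmap n) : seq C :=
  [seq local_deriv (reval f) p | p <- fixed_points f].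

Definition elem_sym (k : nat) (s : seq C) : C :=
  \sum_(I : {set 'I_(size s)} | #|I| == k) \prod_(i in I) s`_i.

Definition sigma n (k : nat) (f : ratmap n) : C := elem_sym k (multipliers f).

Definition conjugate n (f g : ratmap n) : Prop :=
  exists mu : ratmap 1, forall x, reval g (reval mu x) = reval mu (reval f x).

Definition moduli n : Type :=
  set_type [set [set g | conjugate f g] | f in @bicritical n].

(* [X = bc/(ad-bc)] read off from any member of the class of the form
   [(az^n+b)/(cz^n+d)]. *)
Definition modX n (K : moduli n) : C :=
  xget 0 [set x | exists (f : ratmap n) (a b c d : C),
    [/\ sval K f, a * d - b * c != 0, rnum f = a *: 'X^n + b%:P,
        rden f = c *: 'X^n + d%:P & x = b * c / (a * d - b * c)]].

Definition mod_sigma n (k : nat) (K : moduli n) : C :=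
  xget 0 [set s | exists2 f, sval K f & s = sigma k f].

(* [inr] is the line at infinity. *)
Definition ext_moduli_pt n : Type := (moduli n + C)%type.

Definition finite_chart n : chart (C * C) (ext_moduli_pt n) :=
  Chart [set x | exists K, x = inl K]
    (fun x => if x is inl K then (modX K, mod_sigma n K) else (0, 0)).

Definition infinite_chart n : chart (C * C) (ext_moduli_pt n) :=
  Chart [set x | if x is inl K then modX K <> 0 else True]
    (fun x => match x with
     | inl K => ((modX K)^-1,
                 mod_sigma n K / (n%:R ^+ n.+1 * modX K ^+ n.-1))
     | inr s => (0, s)
     end).

Definition ext_atlas n : atlas (C * C) (ext_moduli_pt n) :=
  [set finite_chart n; infinite_chart n].

Definition ext_moduli n := charted (@ext_atlas n).

Definition extX n (x : ext_moduli n) : sphere :=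
  match x with inl K => Some (modX K) | inr _ => None end.

End Bicritical.

Arguments sphere_atlas R : clear implicits.
Arguments ext_atlas R n : clear implicits.
Arguments extX R n : clear implicits.
Arguments model_atlas E : clear implicits.

(* Main.v *)
Require Import Defs.
From HB Require Import structures.
From mathcomp Require Import all_boot all_order all_algebra perm ring zify.
From mathcomp Require Import all_classical all_reals topology normedtype derive.
From mathcomp Require Import complex.

Set Implicit Arguments.
Unset Strict Implicit.
Unset Printing Implicit Defensive.
Import Order.TTheory GRing.Theory Num.Theory.
Import numFieldNormedType.Exports.
Local Open Scope classical_set_scope.
Local Open Scope ring_scope.

(** The class of [f] is determined by its normal form [(az^n+b)/(cz^n+d)] up to
    scaling the variable and exchanging [0] and [infinity].

    Normal forms exist because the Wronskian [p'q - pq'] of [f = p/q] vanishes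
    at [c] to order one less than the local degree, hence at most [n-1], while
    its total degree, counted at infinity too, is [2n-2]; with only two critical
    points both are totally ramified, so [q(c)p - p(c)q] is a multiple of
    [(z-c)^n] at each of them.

    The multipliers are invariant under conjugation by the chain rule.  Their
    multiplicities need no separate argument: a fixed point whose multiplier is
    not [1] is simple, and the total number is [n+1].  For a normal form with
    [bc <> 0] one has [1/lambda = (a/(a-cz) + b/(dz-b))/n] at the fixed point
    [z], and logarithmic derivatives of the fixed point polynomial yield
    [sigma_n = n^n (Y + (2X+1-n) X^(n-1))]; so [(X, sigma_n)] and [(X, Y)] carry
    the same information.  Finally [X] and [Y] determine
    [a^(n+1)b^(n-1)] and [c^(n-1)d^(n+1)] up to order, being their sum and, via
    [X], their product, and a scaling matches the coefficients.

    The geometric part only uses that the two charts are bijections onto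
    [C * C], that they lie over the two charts of the sphere, and that the
    transition map is [(X, s) |-> (1/X, s * const * X^(1-n))]. *)

(** * Rational maps as homogeneous pairs *)

(** Homogenization of formal degree n, that is y^n p(x/y). With it infinity, the direction (1, 0),
    needs no separate treatment. *)
Definition hev (C : comNzRingType) (n : nat) (p : {poly C}) (x y : C) : C :=
  \sum_(i < n.+1) p`_i * x ^+ i * y ^+ (n - i).

Lemma hev_horner (C : comNzRingType) n (p : {poly C}) z :
  (size p <= n.+1)%N -> hev n p z 1 = p.[z].
Proof.
move=> sp; rewrite (horner_coef_wide _ sp); apply: eq_bigr => i _.
by rewrite expr1n mulr1.
Qed.

Lemma hev_coef (C : comNzRingType) n (p : {poly C}) x :
  hev n p x 0 = p`_n * x ^+ n.
Proof.
rewrite /hev big_ord_recr /= subnn expr0 mulr1 big1 ?add0r// => i _.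
by rewrite expr0n subn_eq0 leqNgt ltn_ord mulr0.
Qed.

Lemma hev_rev (C : comNzRingType) n (p : {poly C}) w :
  hev n p 1 w = (\poly_(i < n.+1) p`_(n - i)).[w].
Proof.
rewrite horner_poly /hev (reindex_inj rev_ord_inj) /=; apply: eq_bigr => i _.
by rewrite expr1n mulr1 subSS subKn // -ltnS.
Qed.

Lemma hev_hom (C : comNzRingType) n (p : {poly C}) k x y :
  hev n p (k * x) (k * y) = k ^+ n * hev n p x y.
Proof.
rewrite /hev mulr_sumr; apply: eq_bigr => -[i /= lin] _.
rewrite -[in k ^+ n](subnKC (lin : (i <= n)%N)) exprD !exprMn; ring.
Qed.

Lemma hev_affine (C : fieldType) n (p : {poly C}) x y :
  (size p <= n.+1)%N -> y != 0 -> hev n p x y = y ^+ n * p.[x / y].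
Proof.
by move=> sp y0; rewrite -(hev_horner _ sp) -hev_hom mulr1 mulrC mulfVK.
Qed.

Lemma hev_lin (C : comNzRingType) n (p q : {poly C}) a b x y :
  hev n (a *: p + b *: q) x y = a * hev n p x y + b * hev n q x y.
Proof.
rewrite /hev !mulr_sumr -big_split; apply: eq_bigr => i _ /=.
rewrite coefD !coefZ; ring.
Qed.

Lemma hev_XnC (C : comNzRingType) n (a b x y : C) : (0 < n)%N ->
  hev n (a *: 'X^n + b%:P) x y = a * x ^+ n + b * y ^+ n.
Proof.
case: n => // n _; rewrite /hev big_ord_recl big_ord_recr /= /bump /= add1n.
rewrite !coefD !coefZ !coefXn !coefC !eqxx big1 ?add0r.
  by rewrite subn0 subnn !expr0 /=; ring.
by move=> [i /= lin] _; rewrite coefD coefZ coefXn coefC /= add1n ltn_eqF ?ltnS //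
  mulr0 add0r !mul0r.
Qed.

(** The point [x : y] of the projective line. The pair (0, 0), also sent to [None], is excluded by
    [nzvec] wherever it matters. *)
Definition proj (C : fieldType) (x y : C) : option C :=
  if y == 0 then None else Some (x / y).

Definition nzvec (C : fieldType) (x y : C) := (x != 0) || (y != 0).

Lemma proj_surj (C : fieldType) (p : option C) :
  exists x y : C, nzvec x y /\ p = proj x y.
Proof.
case: p => [z|]; first by exists z, 1; rewrite /nzvec /proj oner_eq0 orbT divr1.
by exists 1, 0; rewrite /nzvec /proj oner_eq0 eqxx.
Qed.

Lemma proj_eq (C : fieldType) (x y x' y' : C) : nzvec x y -> nzvec x' y' ->
  proj x y = proj x' y' <-> x * y' = x' * y.
Proof.
rewrite /nzvec /proj; have [->|y0] := eqVneq y 0; have [->|y0'] := eqVneq y' 0.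
- by rewrite !mulr0.
- rewrite orbF mulr0 => x0 _; split=> // /eqP.
  by rewrite mulf_eq0 (negPf x0) (negPf y0').
- rewrite orbF mulr0 => _ x0; split=> // /esym/eqP.
  by rewrite mulf_eq0 (negPf x0) (negPf y0).
move=> _ _; split=> [[]/eqP|e]; first by rewrite eqr_div // => /eqP ->.
by congr Some; apply/eqP; rewrite eqr_div // e.
Qed.

Lemma proj_scale (C : fieldType) (k x y : C) : k != 0 ->
  proj (k * x) (k * y) = proj x y.
Proof.
move=> k0; rewrite /proj mulf_eq0 (negPf k0) /=; case: eqP => // _.
by rewrite -mulf_div divff // mul1r.
Qed.

Lemma ratmap_size (R : realType) n (f : ratmap R n) :
  (size (rnum f) <= n.+1)%N /\ (size (rden f) <= n.+1)%N.
Proof. by rewrite -(rdegree f) leq_maxl leq_maxr. Qed.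

Lemma ratmap_lead (R : realType) n (f : ratmap R n) :
  nzvec (rnum f)`_n (rden f)`_n.
Proof.
have lead (p : {poly Cx R}) : size p = n.+1 -> p`_n != 0.
  by move=> e; rewrite -[n]/n.+1.-1 -e -lead_coefE lead_coef_eq0 -size_poly_eq0 e.
by have := rdegree f; rewrite /nzvec /maxn; case: ifP => _ /lead -> //; rewrite orbT.
Qed.

Lemma coprimep_nzvec (C : closedFieldType) (p q : {poly C}) :
  coprimep p q <-> forall z, nzvec p.[z] q.[z].
Proof.
split=> [/Pdiv.ClosedField.coprimepP h z|h].
  by rewrite /nzvec; have [/eqP/h ->|] := eqVneq p.[z] 0; rewrite ?orbT.
apply/Pdiv.ClosedField.coprimepP => z /rootP pz.
by have := h z; rewrite /nzvec pz eqxx.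
Qed.

Lemma ratmap_hev (R : realType) n (f : ratmap R n) x y : nzvec x y ->
  nzvec (hev n (rnum f) x y) (hev n (rden f) x y).
Proof.
have [sp sq] := ratmap_size f.
have [->|y0] := eqVneq y 0.
  rewrite /nzvec !hev_coef eqxx orbF => x0.
  by rewrite !mulf_eq0 (negPf (expf_neq0 _ x0)) !orbF; exact: ratmap_lead.
move=> _; rewrite /nzvec !hev_affine // !mulf_eq0 (negPf (expf_neq0 _ y0)).
exact: (coprimep_nzvec (C := Cx R) _ _).1 (rcoprime f) _.
Qed.

Lemma reval_proj (R : realType) n (f : ratmap R n) x y : nzvec x y ->
  reval f (proj x y) = proj (hev n (rnum f) x y) (hev n (rden f) x y).
Proof.
have [sp sq] := ratmap_size f; rewrite {1}/proj.
have [->|y0 _] := eqVneq y 0.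
  rewrite /nzvec eqxx orbF => x0; rewrite !hev_coef ![_ * x ^+ n]mulrC.
  by rewrite proj_scale // expf_neq0.
by rewrite !hev_affine // proj_scale // expf_neq0.
Qed.

(** The absence of a common projective zero encodes both conditions on a rational map: at (z, 1) it
    is coprimality, at (1, 0) it says that one of the polynomials has degree exactly n. *)
Lemma ratmap_exists (R : realType) n (p q : {poly Cx R}) :
  (size p <= n.+1)%N -> (size q <= n.+1)%N ->
  (forall x y, nzvec x y -> nzvec (hev n p x y) (hev n q x y)) ->
  exists f : ratmap R n, rnum f = p /\ rden f = q.
Proof.
move=> sp sq nz.
have cpq : coprimep p q.
  apply/(coprimep_nzvec (C := Cx R)) => z.
  by rewrite -!(@hev_horner _ n) //; apply: nz; rewrite /nzvec oner_eq0 orbT.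
have dpq : maxn (size p) (size q) = n.+1.
  apply/eqP; rewrite eqn_leq geq_max sp sq /= leq_max.
  have := nz 1 0; rewrite /nzvec oner_eq0 !hev_coef expr1n !mulr1 => /(_ isT).
  by case/orP => h; apply/orP; [left|right]; rewrite ltnNge; apply: contra h => h;
    rewrite nth_default.
by exists (Ratmap cpq dpq).
Qed.

(** * Derivatives in local coordinates *)

Lemma is_derive_horner (K : numFieldType) (p : {poly K}) (x : K) :
  is_derive x (1 : K) (horner p) p^`().[x].
Proof.
elim/poly_ind: p => [|p r ih].
  have -> : horner (0 : {poly K}) = cst 0 by apply/funext => y; rewrite horner0.
  by rewrite deriv0 horner0; exact: is_derive_cst.
have -> : horner (p * 'X + r%:P) = (horner p * id) + cst r.
  by apply/funext => y; rewrite !hornerE !fctE.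
apply: is_derive_eq.
by rewrite derivD derivM derivC derivX !hornerE /= [_%:A]mulr1 addrC [_ *: _]mulrC.
Qed.

Lemma continuous_horner (K : numFieldType) (p : {poly K}) : continuous (horner p).
Proof.
move=> x; apply/differentiable_continuous/derivable1_diffP.
exact: (@ex_derive _ _ _ _ _ _ _ (is_derive_horner p x)).
Qed.

Lemma near_horner_neq0 (K : numFieldType) (p : {poly K}) (x : K) :
  p.[x] != 0 -> \forall w \near x, p.[w] != 0.
Proof.
exact: (@cvgr_neq0 K K^o _ _ _ (horner p) _ (@continuous_horner K p x)).
Qed.

Lemma is_derive_hornerV (K : numFieldType) (p q : {poly K}) (x : K) :
  q.[x] != 0 -> is_derive x (1 : K) (fun w => p.[w] / q.[w])
    ((p^`().[x] * q.[x] - p.[x] * q^`().[x]) / q.[x] ^+ 2).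
Proof.
move=> q0.
have [dp ep] := is_derive_horner p x; have [dq eq] := is_derive_horner q x.
have dV : derivable (fun y => q.[y]^-1) x 1 by exact: derivableV.
apply: DeriveDef; first exact: (derivableM dp dV).
rewrite (deriveM dp dV) (deriveV q0 dq) ep eq.
by rewrite /GRing.scale /=; field.
Qed.

Lemma derive1_chain (K : numFieldType) (f g : K -> K) x y :
  f x = y -> derivable f x 1 -> derivable g y 1 ->
  (g \o f)^`()%classic x = g^`()%classic y * f^`()%classic x.
Proof.
move=> <- /derivable1_diffP df /derivable1_diffP dg.
rewrite derive1E'; last exact/differentiable_comp.
rewrite diff_comp // !derive1E' //= -[X in 'd  _ _ X = _]mulr1.
by rewrite [LHS]linearZ mulrC.
Qed.

(* [in_chart p x]: the point [x] lies in the domain of [local_coord p]. *)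
Definition in_chart (R : realType) (p x : sphere_pt R) : Prop :=
  local_param p (local_coord p x) = x.

Definition local_rep (R : realType) (f : sphere_pt R -> sphere_pt R) p (w : Cx R) :=
  local_coord (f p) (f (local_param p w)).

(** Outside its domain [local_coord] takes the default value 0. The second clause keeps nearby
    values inside the domain, so that representatives can be composed. *)
Definition local_smooth (R : realType) (f : sphere_pt R -> sphere_pt R) p :=
  derivable (local_rep f p) (local_coord p p) 1 /\
  \forall w \near local_coord p p, in_chart (f p) (f (local_param p w)).

Lemma in_chart_self (R : realType) (p : sphere_pt R) : in_chart p p.
Proof. by case: p => [z|] //; rewrite /in_chart /= eqxx. Qed.

(** The representative of a composite is the composite of the representatives only near the base
    point, which is enough for the derivative; then the usual chain rule applies. *)
Lemma local_deriv_comp (R : realType) (f h : sphere_pt R -> sphere_pt R) p :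
  local_smooth f p -> local_smooth h (f p) ->
  local_deriv (h \o f) p = local_deriv h (f p) * local_deriv f p.
Proof.
move=> [df cf] [dh _].
have fp : local_rep f p (local_coord p p) = local_coord (f p) (f p).
  by rewrite /local_rep in_chart_self.
transitivity ((local_rep h (f p) \o local_rep f p)^`()%classic (local_coord p p)).
  rewrite /local_deriv !derive1E; apply: near_eq_derive; near=> w.
  have e : in_chart (f p) (f (local_param p w)) by near: w.
  by rewrite /local_rep /= e.
exact: derive1_chain fp df dh.
Unshelve. all: by end_near. Qed.

(* The coefficients of [q] read in the source coordinate [local_param p]. *)
Definition chart_poly (C : nzRingType) n (p : option C) (q : {poly C}) : {poly C} :=
  if p is Some _ then q else \poly_(i < n.+1) q`_(n - i).

Lemma chart_polyE (R : realType) n (p : sphere_pt R) (q : {poly Cx R}) w :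
  (size q <= n.+1)%N -> (chart_poly n p q).[w] =
  if p is Some _ then hev n q w 1 else hev n q 1 w.
Proof. by case: p => [z|] sq; rewrite /chart_poly ?hev_horner ?hev_rev. Qed.

Lemma local_paramE (R : realType) (p : sphere_pt R) w :
  local_param p w = if p is Some _ then proj w 1 else proj 1 w.
Proof.
by case: p => [z|]; rewrite /proj /= ?oner_eq0 ?divr1 // mul1r.
Qed.

Section LocalRep.
Variables (R : realType) (n : nat) (f : ratmap R n) (p : sphere_pt R).
Let P := chart_poly n p (rnum f).
Let Q := chart_poly n p (rden f).
Let z := local_coord p p.

Lemma reval_local_param w :
  nzvec P.[w] Q.[w] /\ reval f (local_param p w) = proj P.[w] Q.[w].
Proof.
have [sp sq] := ratmap_size f.
rewrite /P /Q !chart_polyE // local_paramE.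
have n1 : nzvec w 1 by rewrite /nzvec oner_eq0 orbT.
have n2 : nzvec 1 w by rewrite /nzvec oner_eq0.
by case: (p) => [?|]; rewrite -reval_proj //; split=> //; apply: ratmap_hev.
Qed.

Lemma reval_chart_poly : nzvec P.[z] Q.[z] /\ reval f p = proj P.[z] Q.[z].
Proof. by have := reval_local_param z; rewrite in_chart_self. Qed.

(** An equality of total functions: where the value leaves the chart, the default 0 of [local_coord]
    agrees with division by 0. *)
Lemma local_repE : local_rep (reval f) p =
  if Q.[z] == 0 then (fun w => Q.[w] / P.[w]) else (fun w => P.[w] / Q.[w]).
Proof.
have [_ e] := reval_chart_poly; apply/funext => w; rewrite /local_rep e.
have [_ ->] := reval_local_param w; rewrite /proj.
have [_|_] := eqVneq Q.[z] 0; have [->|_] //= := eqVneq Q.[w] 0.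
- by rewrite mul0r.
- by rewrite invf_div.
- by rewrite invr0 mulr0.
Qed.

Lemma local_smooth_reval : local_smooth (reval f) p.
Proof.
have [nz e] := reval_chart_poly; rewrite /local_smooth local_repE.
have [Q0|Q0] := eqVneq Q.[z] 0.
  have P0 : P.[z] != 0 by move: nz; rewrite /nzvec Q0 eqxx orbF.
  split; first by case: (is_derive_hornerV Q P0).
  apply: filterS (near_horner_neq0 P0) => w Pw; rewrite e Q0 (reval_local_param w).2.
  rewrite /proj eqxx /in_chart /=.
  have [Qw|Qw] /= := eqVneq Q.[w] 0; first by rewrite eqxx.
  by rewrite invr_eq0 mulf_eq0 invr_eq0 (negPf Pw) (negPf Qw) /= invrK.
split; first by case: (is_derive_hornerV P Q0).
apply: filterS (near_horner_neq0 Q0) => w Qw; rewrite e (reval_local_param w).2.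
by rewrite /proj (negPf Q0) (negPf Qw).
Qed.

Lemma local_derivE : local_deriv (reval f) p =
  if Q.[z] == 0 then (Q^`().[z] * P.[z] - Q.[z] * P^`().[z]) / P.[z] ^+ 2
  else (P^`().[z] * Q.[z] - P.[z] * Q^`().[z]) / Q.[z] ^+ 2.
Proof.
have [nz e] := reval_chart_poly.
rewrite /local_deriv -/(local_rep (reval f) p) local_repE derive1E.
have [Q0|Q0] := eqVneq Q.[z] 0.
  have P0 : P.[z] != 0 by move: nz; rewrite /nzvec Q0 eqxx orbF.
  exact: (@derive_val _ _ _ _ _ _ _ (is_derive_hornerV Q P0)).
exact: (@derive_val _ _ _ _ _ _ _ (is_derive_hornerV P Q0)).
Qed.

(** In either target coordinate the numerator of the derivative is the Wronskian up to sign, over a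
    nonzero square. *)
Lemma local_deriv_eq0 : (local_deriv (reval f) p == 0) =
  ((P^`() * Q - P * Q^`()).[z] == 0).
Proof.
have [nz e] := reval_chart_poly; rewrite local_derivE !hornerE.
have [Q0|Q0] := eqVneq Q.[z] 0.
  have P0 : P.[z] != 0 by move: nz; rewrite /nzvec Q0 eqxx orbF.
  rewrite mulf_eq0 invr_eq0 expf_eq0 (negPf P0) orbF -oppr_eq0 opprB.
  by rewrite [Q.[z] * _]mulrC [P.[z] * _]mulrC.
by rewrite mulf_eq0 invr_eq0 expf_eq0 (negPf Q0) orbF.
Qed.

End LocalRep.

(** * Invariance of the multipliers *)

Lemma hev1 (C : comNzRingType) (p : {poly C}) x y :
  hev 1 p x y = p`_1 * x + p`_0 * y.
Proof. by rewrite /hev big_ord_recl big_ord1 /= !expr1 !expr0 !mulr1 addrC. Qed.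

Lemma nzvec_lin (C : fieldType) (a b c d x y : C) : a * d - b * c != 0 ->
  nzvec x y -> nzvec (a * x + b * y) (c * x + d * y).
Proof.
move=> D0; apply: contraLR; rewrite /nzvec !negb_or !negbK => /andP[/eqP e1 /eqP e2].
have ex : (a * d - b * c) * x = 0.
  transitivity (d * (a * x + b * y) - b * (c * x + d * y)); first by ring.
  by rewrite e1 e2; ring.
have ey : (a * d - b * c) * y = 0.
  transitivity (a * (c * x + d * y) - c * (a * x + b * y)); first by ring.
  by rewrite e1 e2; ring.
by move/eqP: ex; move/eqP: ey; rewrite !mulf_eq0 (negPf D0) /= => -> ->.
Qed.

Lemma moebius_exists (R : realType) (a b c d : Cx R) : a * d - b * c != 0 ->
  exists mu : ratmap R 1, forall x y, nzvec x y ->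
    reval mu (proj x y) = proj (a * x + b * y) (c * x + d * y).
Proof.
move=> D0.
have sz (u v : Cx R) : (size (u *: 'X^1 + v%:P)%R <= 2)%N.
  apply: leq_trans (size_polyD _ _) _; rewrite geq_max.
  rewrite (leq_trans (size_scale_leq _ _)) ?size_polyXn //.
  by rewrite (leq_trans (size_polyC_leq1 _)).
have [||x y nz|mu [en ed]] := @ratmap_exists R 1 (a *: 'X^1 + b%:P) (c *: 'X^1 + d%:P).
- exact: sz.
- exact: sz.
- by rewrite !hev_XnC // !expr1; exact: nzvec_lin.
by exists mu => x y nz; rewrite reval_proj // en ed !hev_XnC // !expr1.
Qed.

Lemma moebiusP (R : realType) (mu : ratmap R 1) : exists a b c d : Cx R,
  a * d - b * c != 0 /\ forall x y, nzvec x y ->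
    reval mu (proj x y) = proj (a * x + b * y) (c * x + d * y).
Proof.
exists (rnum mu)`_1, (rnum mu)`_0, (rden mu)`_1, (rden mu)`_0.
split=> [|x y nz]; last by rewrite reval_proj // !hev1.
apply/negP => /eqP D0.
(* If the determinant vanishes, (-b, a) and (-d, c) are common zeros of the two linear forms. Hence
   all coefficients vanish, and (1, 0) becomes a forbidden common zero. *)
have zero x y : hev 1 (rnum mu) x y = 0 -> hev 1 (rden mu) x y = 0 -> x = 0 /\ y = 0.
  move=> e1 e2; have := @ratmap_hev R 1 mu x y; rewrite {2}/nzvec e1 e2 eqxx.
  by rewrite /nzvec; do 2!case: eqP => //; move=> _ _ /(_ isT).
have [||e0 e1] := zero (- (rnum mu)`_0) (rnum mu)`_1.
- by rewrite hev1; ring.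
- by rewrite hev1; apply: etrans D0; ring.
have [||e2 e3] := zero (- (rden mu)`_0) (rden mu)`_1.
- by move/eqP: e0; rewrite oppr_eq0 hev1 e1 => /eqP ->; ring.
- by rewrite hev1; ring.
have [||/eqP] := zero 1 0.
- by rewrite hev1 e1; ring.
- by rewrite hev1 e3; ring.
by rewrite oner_eq0.
Qed.

Lemma moebius_inv (R : realType) (mu : ratmap R 1) : exists nu : ratmap R 1,
  cancel (reval mu) (reval nu) /\ cancel (reval nu) (reval mu).
Proof.
have [a [b [c [d [D0 muE]]]]] := moebiusP mu.
(* The inverse comes from the adjugate matrix; the product of the two is the determinant, a scalar
   that [proj] ignores. *)
have D1 : d * a - (- b) * (- c) != 0 by rewrite mulrNN mulrC.
have [nu nuE] := moebius_exists D1; exists nu; split=> p;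
  have [x [y [nz ->]]] := proj_surj p.
  rewrite muE // nuE; last exact: nzvec_lin.
  by rewrite -[RHS](proj_scale _ _ D0); congr proj; ring.
rewrite nuE // muE; last exact: nzvec_lin.
by rewrite -[RHS](proj_scale _ _ D0); congr proj; ring.
Qed.

Lemma moebius_comp (R : realType) (mu nu : ratmap R 1) :
  exists ka : ratmap R 1, reval ka =1 reval mu \o reval nu.
Proof.
have [a [b [c [d [D0 muE]]]]] := moebiusP mu.
have [a' [b' [c' [d' [D0' nuE]]]]] := moebiusP nu.
have D : (a * a' + b * c') * (c * b' + d * d') - (a * b' + b * d') * (c * a' + d * c') != 0.
  by have := mulf_neq0 D0 D0'; congr (_ != 0); ring.
have [ka kaE] := moebius_exists D; exists ka => p /=.
have [x [y [nz ->]]] := proj_surj p.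
rewrite kaE // nuE // muE; last exact: nzvec_lin.
by congr proj; ring.
Qed.

Lemma conjugate_eval (R : realType) n (f g : ratmap R n) :
  reval g =1 reval f -> conjugate f g.
Proof.
move=> e; have D : 1 * 1 - 0 * 0 != 0 :> Cx R by rewrite mulr0 subr0 mulr1 oner_eq0.
have [mu muE] := moebius_exists D.
have muid : reval mu =1 id.
  by move=> p; have [x [y [nz ->]]] := proj_surj p; rewrite muE // !mul1r !mul0r addr0 add0r.
by exists mu => p; rewrite !muid.
Qed.

Lemma conjugate_sym (R : realType) n (f g : ratmap R n) :
  conjugate f g -> conjugate g f.
Proof.
move=> [mu e]; have [nu [nK mK]] := moebius_inv mu.
by exists nu => p; rewrite -[in RHS](mK p) e nK.
Qed.

Lemma conjugate_trans (R : realType) n (f g h : ratmap R n) :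
  conjugate f g -> conjugate g h -> conjugate f h.
Proof.
move=> [mu e] [nu e']; have [ka kE] := moebius_comp nu mu.
by exists ka => p; rewrite !kE /= e' e.
Qed.

Lemma local_deriv_id (R : realType) (p : sphere_pt R) : local_deriv id p = 1.
Proof.
rewrite /local_deriv derive1E.
have -> : (fun w => local_coord p (local_param p w)) = id.
  apply/funext => w; case: p => //=; case: eqVneq => [->//|w0] /=.
  by rewrite invrK.
exact: derive_id.
Qed.

(* Otherwise unification compares multipliers by unfolding the limits. *)
Opaque local_deriv.

(** By the chain rule, the derivatives of a Moebius map and of its inverse multiply to 1. *)
Lemma local_deriv_moebius (R : realType) (mu : ratmap R 1) p :
  local_deriv (reval mu) p != 0.
Proof.
have [nu [nK _]] := moebius_inv mu; apply/eqP => e.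
have := local_deriv_comp (local_smooth_reval mu p) (local_smooth_reval nu (reval mu p)).
have -> : reval nu \o reval mu = id by apply/funext => x /=; rewrite nK.
by rewrite local_deriv_id e mulr0 => /eqP; rewrite oner_eq0.
Qed.

Lemma mulf_eq0_iff (K : fieldType) (x y a b : K) :
  x * a = b * y -> a != 0 -> b != 0 -> x = 0 <-> y = 0.
Proof.
move=> e a0 b0; split=> z; first by apply: (mulfI b0); rewrite -e z mul0r mulr0.
by apply: (mulIf a0); rewrite e z mul0r mulr0.
Qed.

Section Conjugacy.
Variables (R : realType) (n : nat) (f g : ratmap R n) (mu : ratmap R 1).
Hypothesis fg : forall x, reval g (reval mu x) = reval mu (reval f x).

Lemma local_deriv_conj p :
  local_deriv (reval g) (reval mu p) * local_deriv (reval mu) p =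
  local_deriv (reval mu) (reval f p) * local_deriv (reval f) p.
Proof.
have e1 := local_deriv_comp (local_smooth_reval mu p) (local_smooth_reval g (reval mu p)).
have e2 := local_deriv_comp (local_smooth_reval f p) (local_smooth_reval mu (reval f p)).
apply: etrans (esym e1) _; apply: etrans _ e2.
by have -> : reval g \o reval mu = reval mu \o reval f by apply/funext => x /=; rewrite fg.
Qed.

Lemma critical_conj p :
  critical_points g (reval mu p) <-> critical_points f p.
Proof.
exact: mulf_eq0_iff (local_deriv_conj p) (local_deriv_moebius _ _) (local_deriv_moebius _ _).
Qed.

Lemma fixed_conj p : reval g (reval mu p) = reval mu p <-> reval f p = p.
Proof.
have [nu [nK _]] := moebius_inv mu.
by rewrite fg; split=> [/(can_inj nK)|->].
Qed.

Lemma multiplier_conj p : reval f p = p ->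
  local_deriv (reval g) (reval mu p) = local_deriv (reval f) p.
Proof.
move=> fp; apply: (mulIf (local_deriv_moebius mu p)).
apply: etrans (local_deriv_conj p) _; rewrite fp; exact: mulrC.
Qed.

End Conjugacy.

(** * Fixed points and their multiplicities *)

Section FixedPoints.
Variables (R : realType) (n : nat) (f : ratmap R n).
Hypothesis n_ge2 : (2 <= n)%N.
Let Phi := rnum f - 'X * rden f.
Let s := sval (closed_field_poly_normal Phi).

Let PhiE : Phi = lead_coef Phi *: \prod_(z <- s) ('X - z%:P).
Proof. by rewrite /s; case: closed_field_poly_normal. Qed.

(** Otherwise f would be the identity: p = Xq with p and q coprime makes q constant, and the degree
    is 1. *)
Lemma fixed_poly_neq0 : Phi != 0.
Proof.
apply/eqP => /eqP; rewrite subr_eq0 => /eqP e.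
have := rcoprime f; rewrite e coprimepMl coprimepp => /andP[_ /eqP s1].
have := rdegree f; rewrite e mulrC size_mulX ?s1 //; last by rewrite -size_poly_eq0 s1.
by move=> [] n1; move: n_ge2; rewrite -n1.
Qed.

Let sizePhi : size Phi = (size s).+1.
Proof.
by rewrite {1}PhiE size_scale ?lead_coef_eq0 ?fixed_poly_neq0 // size_prod_XsubC.
Qed.

Let sizePhi_le : (size Phi <= n.+2)%N.
Proof.
have [sp sq] := ratmap_size f.
rewrite (leq_trans (size_polyD _ _)) // geq_max size_polyN leqW //=.
apply: leq_trans (size_polyMleq _ _) _; rewrite size_polyX /=.
by rewrite ltnS.
Qed.

Lemma size_fixed_points : size (fixed_points f) = n.+1.
Proof.
rewrite /fixed_points size_cat size_map size_nseq subnKC //.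
by rewrite -ltnS -sizePhi.
Qed.

Let coefPhi k : Phi`_k.+1 = (rnum f)`_k.+1 - (rden f)`_k.
Proof. by rewrite coefB mulrC coefMX. Qed.

Lemma mem_fixed_points p : p \in fixed_points f <-> reval f p = p.
Proof.
have [sp sq] := ratmap_size f.
rewrite /fixed_points mem_cat; case: p => [z|] /=.
  rewrite mem_nseq andbF orbF mem_map; last by move=> ? ? [].
  have -> : (z \in s) = root Phi z.
    by rewrite PhiE rootZ ?lead_coef_eq0 ?fixed_poly_neq0 // root_prod_XsubC.
  have := (coprimep_nzvec (C := Cx R) _ _).1 (rcoprime f) z.
  rewrite /nzvec rootE !hornerE subr_eq0; have [->|q0] := eqVneq (rden f).[z] 0.
    by rewrite orbF mulr0 => /negPf ->.
  move=> _; split=> [/eqP ->|[e]]; first by rewrite mulfK.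
  by rewrite -(divfK q0 (rnum f).[z]) e.
have -> : (None \in [seq Some i | i <- s]) = false by apply/negbTE/mapP => -[].
rewrite mem_nseq eqxx andbT /= subn_gt0 -sizePhi.
(* The coefficient of degree n+1 in p - Xq is -q_n, so the degree drops exactly when infinity is
   fixed. *)
have -> : (size Phi <= n.+1)%N = ((rden f)`_n == 0).
  apply/idP/idP => [le|/eqP q0].
    have : Phi`_n.+1 = 0 by rewrite nth_default.
    by rewrite coefPhi nth_default // sub0r => /eqP; rewrite oppr_eq0.
  apply/leq_sizeP => j; rewrite leq_eqVlt => /orP[/eqP <-|]; last first.
    by move=> lj; rewrite nth_default // (leq_trans sizePhi_le).
  by rewrite coefPhi q0 nth_default // subr0.
by case: eqP.
Qed.

Lemma count_fixed_points p : reval f p = p -> local_deriv (reval f) p != 1 ->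
  count_mem p (fixed_points f) = 1%N.
Proof.
have [sp sq] := ratmap_size f.
move=> fp; rewrite local_derivE /= => l1.
have /mem_fixed_points := fp.
rewrite /fixed_points mem_cat count_cat -/Phi -/s.
case: p fp l1 => [z|] /= fp l1.
  have q0 : (rden f).[z] != 0 by move: fp => /=; case: eqP.
  have ez : (rnum f).[z] = z * (rden f).[z].
    by move: fp => /=; rewrite (negPf q0) => -[e]; rewrite -[LHS](divfK q0) e.
  rewrite count_nseq mul0n addn0 mem_nseq andbF orbF.
  rewrite mem_map; last by move=> ? ? [].
  move=> zs; rewrite count_map.
  rewrite (@eq_count _ _ (pred1 z)) => [|x]; last by rewrite /= (inj_eq Some_inj).
  have := perm_to_rem zs => ps.
  rewrite (seq.permP ps) /= eqxx; congr S; apply/count_memPn/negP => zr.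
  (* A second occurrence of z makes it a double root of p - Xq. The derivative then gives p'(z) =
     q(z) + z q'(z), which turns the multiplier into 1. *)
  have : (Phi^`()).[z] = 0.
    rewrite PhiE derivZ hornerZ (perm_big _ ps) big_cons derivM !hornerE.
    have /rootP -> : root (\prod_(i <- rem z s) ('X - i%:P)) z by rewrite root_prod_XsubC.
    by rewrite subrr mulr0 mul0r addr0 mulr0.
  rewrite /Phi derivB derivM derivX !hornerE => e; move/negP: l1; apply.
  rewrite (negPf q0) ez; apply/eqP.
  have -> : (rnum f)^`().[z] = (rden f).[z] + z * (rden f)^`().[z].
    by apply/eqP; rewrite -subr_eq0 e.
  by field.
have -> : (None \in [seq Some i | i <- s]) = false by apply/negbTE/mapP => -[].
move=> _; rewrite count_nseq mul1n (_ : count _ _ = 0%N) ?add0n; last first.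
  by apply/count_memPn/mapP => -[].
have q0 : (rden f)`_n = 0 by move: fp => /=; case: eqP.
have p0 : (rnum f)`_n != 0.
  by have := ratmap_lead f; rewrite /nzvec q0 eqxx orbF.
have n0 : (0 < n)%N by apply: leq_trans n_ge2.
have Phin : Phi`_n = (rnum f)`_n - (rden f)`_(n - 1).
  by rewrite -[in LHS](prednK n0) coefPhi prednK // subn1.
(* At a fixed infinity the multiplier is q_(n-1)/p_n. If it is not 1, the degree of p - Xq drops by
   one only, and infinity is counted once. *)
have Phin0 : Phi`_n != 0.
  rewrite Phin subr_eq0; apply: contraNneq l1 => e.
  rewrite !horner_coef0 !coef_deriv !coef_poly /= ltnS n0 subn0 q0 eqxx.
  by rewrite mul0r subr0 mulr1n -e; apply/eqP; field.
have Phin1 : Phi`_n.+1 = 0 by rewrite coefPhi q0 nth_default ?subr0.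
suff : size Phi = n.+1 by rewrite sizePhi => -[->]; rewrite subSnn.
apply/eqP; rewrite eqn_leq; apply/andP; split.
  apply/leq_sizeP => j; rewrite leq_eqVlt => /orP[/eqP <- //|lj].
  by rewrite nth_default // (leq_trans sizePhi_le).
by rewrite ltnNge; apply: contra Phin0 => le; rewrite nth_default.
Qed.

End FixedPoints.

(* The entries with value [1] are determined by the total size, so only the
   simple entries have to be matched. *)
Lemma map_padding (T S : eqType) (l : T -> S) (one : S) (r : seq T) :
  (forall p, p \in r -> l p != one -> count_mem p r = 1%N) ->
  let s := [seq p <- r | l p != one] in
  uniq s /\ perm_eq (map l r) (map l s ++ nseq (size r - size s) one).
Proof.
move=> simp s; split.
  apply: count_mem_uniq => p; rewrite mem_filter count_filter.
  have [l1|l1] := boolP (l p != one) => /=.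
    rewrite (@eq_count _ _ (pred1 p)) => [|x /=]; last first.
      by case: eqP => // ->; rewrite l1.
    have [pf|/count_memPn ->//] := boolP (p \in r).
    by rewrite simp.
  rewrite (@eq_count _ _ pred0) ?count_pred0 // => x /=.
  by case: eqP => // ->; rewrite (negPf l1).
have /permPl <- := perm_map l (permEl (perm_filterC (fun p => l p != one) r)).
rewrite map_cat perm_cat2l.
rewrite -(count_predC (fun p => l p != one) r) size_filter addKn.
rewrite -size_filter; set t := seq.filter _ r.
have /all_pred1P : all (pred1 one) [seq l i | i <- t].
  by rewrite all_map; apply/allP => x; rewrite mem_filter /= negbK => /andP[].
by rewrite size_map => ->.
Qed.

(** The bijection [mu] matches the entries whose label is not [one]; what remains is padding, whose
    length is fixed by the common total size. *)
Lemma perm_map_padded (T S : eqType) (l l' : T -> S) (one : S) (r r' : seq T)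
    (mu nu : T -> T) : size r = size r' -> cancel mu nu -> cancel nu mu ->
  (forall p, p \in r -> l p != one -> count_mem p r = 1%N) ->
  (forall p, p \in r' -> l' p != one -> count_mem p r' = 1%N) ->
  (forall p, (mu p \in r') = (p \in r)) ->
  (forall p, p \in r -> l' (mu p) = l p) ->
  perm_eq (map l' r') (map l r).
Proof.
move=> sr nK mK /map_padding[uf pf] /map_padding[ug pg] fp lp.
rewrite (permPl pg) perm_sym (permPl pf) perm_sym -sr.
set sf := seq.filter _ r in uf *; set sg := seq.filter _ r' in ug *.
have sgE : perm_eq sg (map mu sf).
  apply: uniq_perm => //; first by rewrite map_inj_uniq //; exact: can_inj nK.
  move=> p; rewrite -(mK p) mem_map; last exact: can_inj nK.
  by rewrite !mem_filter fp andbC [RHS]andbC; have [/lp ->|] := boolP (_ \in r).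
rewrite (perm_size sgE) size_map perm_cat2r (permPl (perm_map _ sgE)) -map_comp.
have -> : map (l' \o mu) sf = map l sf; last exact: perm_refl.
by apply/eq_in_map => p; rewrite mem_filter => /andP[_]; exact: lp.
Qed.

Lemma multipliers_conj (R : realType) n (f g : ratmap R n) : (2 <= n)%N ->
  conjugate f g -> perm_eq (multipliers g) (multipliers f).
Proof.
move=> n2 [mu fg]; have [nu [nK mK]] := moebius_inv mu.
apply: (perm_map_padded (one := 1) _ nK mK).
- by rewrite !size_fixed_points.
- by move=> p /mem_fixed_points fp; exact: count_fixed_points (fp n2).
- by move=> p /mem_fixed_points fp; exact: count_fixed_points (fp n2).
- move=> p; apply/idP/idP => /mem_fixed_points fp; apply/mem_fixed_points => //.
    exact/(fixed_conj fg)/fp.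
  exact/(fixed_conj fg)/fp.
- by move=> p /mem_fixed_points fp; have := multiplier_conj fg (fp n2).
Qed.

Lemma elem_sym_perm (R : realType) k (s t : seq (Cx R)) :
  perm_eq s t -> elem_sym k s = elem_sym k t.
Proof.
move=> st; have sst := perm_size st.
have /tuple_permP[q sq] : perm_eq s (in_tuple t) by [].
have nthE (i : 'I_(size t)) : s`_i = t`_(q i).
  by rewrite sq (nth_map i) ?size_enum_ord // nth_ord_enum (tnth_nth 0).
rewrite /elem_sym sst [RHS](reindex_inj (imset_inj (@perm_inj _ q))) /=.
apply: eq_big => [I|I _]; first by rewrite card_imset //; exact: perm_inj.
rewrite big_imset /=; last by move=> ? ? _ _; exact: perm_inj.
by apply: eq_bigr => i _.
Qed.

Lemma sigma_conj (R : realType) n k (f g : ratmap R n) : (2 <= n)%N ->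
  conjugate f g -> sigma k g = sigma k f.
Proof. by move=> n2 fg; apply: elem_sym_perm; exact: multipliers_conj. Qed.

(** * Ramification and the Wronskian *)

Definition wronskian (K : nzRingType) (p q : {poly K}) := p^`() * q - p * q^`().

Lemma wronskian_lin (K : comNzRingType) (p q : {poly K}) a b c d :
  wronskian (a *: p + b *: q) (c *: p + d *: q) = (a * d - b * c) *: wronskian p q.
Proof.
rewrite /wronskian !derivD !derivZ -!mul_polyC rmorphB !rmorphM /=; ring.
Qed.

(** Completes the row (v, -u) to an invertible matrix. For (u, v) = (p(c), q(c)) the first
    combination vanishes at c, and the second takes there the value av + bu, which is nonzero. *)
Lemma wronskian_comb (K : fieldType) (p q : {poly K}) u v : nzvec u v ->
  exists a b, [/\ a * v + b * u != 0, nzvec a b &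
    wronskian (v *: p - u *: q) (b *: p + a *: q) = (a * v + b * u) *: wronskian p q].
Proof.
rewrite /nzvec; have [u0|u0 _] := eqVneq u 0; last first.
  exists 0, 1; rewrite mul0r mul1r add0r oner_eq0 orbT; split=> //.
  by rewrite -scaleNr wronskian_lin; congr (_ *: _); ring.
rewrite /= => v0; exists 1, 0; rewrite mul0r mul1r addr0 oner_eq0; split=> //.
by rewrite -scaleNr wronskian_lin; congr (_ *: _); ring.
Qed.

Section Ramification.
Variables (K : numClosedFieldType) (n : nat) (p q : {poly K}).
Hypotheses (sp : (size p <= n.+1)%N) (sq : (size q <= n.+1)%N).
Hypothesis W0 : wronskian p q != 0.

Lemma comb_neq0 u v : nzvec u v -> v *: p - u *: q != 0.
Proof.
move=> uv; have [a [b [k0 _ e]]] := wronskian_comb p q uv.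
apply: contra_neq W0 => r0; move/eqP: e.
rewrite r0 /wronskian deriv0 !mul0r subr0 eq_sym scaler_eq0 (negPf k0) /=.
by move/eqP.
Qed.

Lemma size_comb u v : (size (v *: p - u *: q)%R <= n.+1)%N.
Proof.
rewrite (leq_trans (size_polyD _ _)) // geq_max size_polyN.
by rewrite !(leq_trans (size_scale_leq _ _)).
Qed.

(* The multiplicity of the Wronskian at [c] is one less than the local degree
   at [c], hence at most [n - 1], with equality only for total ramification. *)
Lemma mup_wronskian c : nzvec p.[c] q.[c] ->
  (mup c (wronskian p q) < n)%N /\
  ((n <= (mup c (wronskian p q)).+1)%N -> exists k, k != 0 /\
    q.[c] *: p - p.[c] *: q = k *: ('X - c%:P) ^+ n).
Proof.
move=> uv; have [a [b [k0 ab e]]] := wronskian_comb p q uv.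
have r0 := comb_neq0 uv; have sr := size_comb p.[c] q.[c].
set r := _ - _ in r0 sr e *; set s := _ + _ in e.
have sc : s.[c] != 0 by rewrite /s !hornerE addrC.
have rc : r.[c] = 0 by rewrite /r !hornerE mulrC subrr.
clearbody r s.
have [m [r1 /implyP/(_ r0) r1c rE]] := multiplicity_XsubC r c.
have r10 : r1 != 0 by apply: contraNneq r1c => ->; rewrite root0.
have szr : size r = (size r1 + m)%N.
  rewrite rE size_mul // ?expf_eq0 ?polyXsubC_eq0 ?andbF //.
  by rewrite size_exp_XsubC addnS.
have r1s : (0 < size r1)%N by rewrite size_poly_gt0.
case: m => [|m] in rE szr *.
  by move: rc; rewrite rE expr0 mulr1 => /eqP; rewrite -rootE (negPf r1c).
have mn : (m < n)%N 
  by rewrite -ltnS; apply: leq_trans sr; rewrite szr -[X in (X < _)%N]add0n ltn_add2r.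
(* What is left of the Wronskian of r = r1 (X-c)^(m+1) and s after removing (X-c)^m. At c it equals
   (m+1) r1(c) s(c), nonzero in characteristic 0. *)
pose V := (m.+1%:R *: r1) * s + ('X - c%:P) * wronskian r1 s.
have VE : (a * q.[c] + b * p.[c]) *: wronskian p q = V * ('X - c%:P) ^+ m.
  rewrite -e rE /V /wronskian derivM deriv_exp derivXsubC /= exprS -mulr_natr.
  rewrite -mul_polyC polyC_natr; ring.
have Vc : ~~ root V c.
  rewrite rootE /V !hornerE subrr mul0r addr0 !mulf_eq0 pnatr_eq0 (negPf sc) orbF.
  exact: r1c.
have mW : mup c (wronskian p q) = m.
  have -> : wronskian p q = ((a * q.[c] + b * p.[c])^-1 *: V) * ('X - c%:P) ^+ m.
    by rewrite -scalerAl -VE scalerA mulVf ?scale1r.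
  rewrite mupMr ?mup_XsubCX ?eqxx //.
  by rewrite rootZ // invr_eq0.
rewrite mW; split=> // nm.
have nE : n = m.+1 by apply/eqP; rewrite eqn_leq nm.
have /eqP/size_poly1P[k kn0 r1E] : size r1 = 1%N.
  have : (size r1 + m.+1 <= 1 + m.+1)%N by rewrite -szr -nE.
  by rewrite leq_add2r => le; apply/eqP; rewrite eqn_leq le.
by exists k; split=> //; rewrite rE r1E nE mul_polyC.
Qed.

Lemma coefM_top (a b : {poly K}) i j : (size a <= i.+1)%N -> (size b <= j.+1)%N ->
  (a * b)`_(i + j) = a`_i * b`_j.
Proof.
move=> sa sb; have li : (i < (i + j).+1)%N by rewrite ltnS leq_addr.
rewrite coefM (bigD1 (Ordinal li)) //= addKn big1 ?addr0 // => -[k lk] /=.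
rewrite -val_eqE /= neq_ltn => /orP[lt|lt]; last by rewrite nth_default ?mul0r // (leq_trans sa).
rewrite [b`_ _]nth_default ?mulr0 // (leq_trans sb) // ltn_subRL addnC.
by rewrite addnC ltn_add2r.
Qed.

(** The counterpart of [mup_wronskian] at infinity: the combination [r] loses its coefficient of
    degree n, and its degree measures the ramification there. *)
Lemma size_wronskian : nzvec p`_n q`_n ->
  let r := q`_n *: p - p`_n *: q in
  (size r <= n)%N /\ (size (wronskian p q)).+1 = (size r + n)%N.
Proof.
move=> uv r; have [a [b [k0 ab e]]] := wronskian_comb p q uv.
have r0 : r != 0 := comb_neq0 uv; have sr : (size r <= n.+1)%N := size_comb p`_n q`_n.
have ss : (size (b *: p + a *: q)%R <= n.+1)%N.
  by have := size_comb (- a) b; rewrite scaleNr opprK.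
rewrite -/r in e; set s := _ + _ in ss e.
have sn : s`_n != 0 by rewrite /s coefD !coefZ addrC.
have rn : r`_n = 0 by rewrite /r coefB !coefZ mulrC subrr.
have srn : (size r <= n)%N.
  by apply/leq_sizeP => j; rewrite leq_eqVlt => /orP[/eqP <- //|lj]; rewrite nth_default // (leq_trans sr).
split=> //; have [d dE] : exists d, size r = d.+1.
  by exists (size r).-1; rewrite prednK // size_poly_gt0.
have rd : r`_d != 0 by rewrite -[d]/d.+1.-1 -dE -lead_coefE lead_coef_eq0.
have sX (t : {poly K}) k : (size t <= k.+1)%N -> (size ('X * t^`())%R <= k.+1)%N.
  move=> st; apply/leq_sizeP => -[//|j] lj.
  by rewrite coefXM /= coef_deriv nth_default ?mul0rn // (leq_trans st).
have cX (t : {poly K}) k : ('X * t^`())`_k = t`_k *+ k.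
  by rewrite coefXM coef_deriv; case: k => //=; rewrite mulr0n.
(* The operator X d/dX multiplies the coefficient of degree k by k, so the coefficient of degree d +
   n in [T] is (d - n) r_d s_n. It is nonzero because d < n. *)
pose T := ('X * r^`()) * s - r * ('X * s^`()).
have TE : T = 'X * ((a * q`_n + b * p`_n) *: wronskian p q).
  by rewrite -e /T /wronskian; ring.
have sT : size T = (d + n).+1.
  apply/eqP; rewrite eqn_leq; apply/andP; split.
    rewrite (leq_trans (size_polyD _ _)) // geq_max size_polyN.
    by rewrite !(leq_trans (size_polyMleq _ _)) // -subn1 leq_subLR add1n -addSn -addnS leq_add // ?sX // dE.
  rewrite ltnNge; apply: contraTN isT => /leq_sizeP/(_ _ (leqnn _)).
  rewrite coefB !coefM_top ?sX ?dE // !cX.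
  rewrite mulrnAl mulrnAr => /eqP; rewrite subr_eq0 => /eqP/(congr1 (fun x => x / (r`_d * s`_n))).
  have rs0 : r`_d * s`_n != 0 by rewrite mulf_neq0.
  rewrite -mulr_natr -[in RHS]mulr_natr ![_ * _%:R]mulrC !mulfK // => /eqP.
  by rewrite eqr_nat => /eqP dn; move: srn; rewrite dE dn ltnn.
have kW0 : (a * q`_n + b * p`_n) *: wronskian p q != 0 by rewrite scaler_eq0 negb_or k0.
by move: sT; rewrite TE mulrC size_mulX // size_scale // dE => ->.
Qed.

End Ramification.

(** Multiplicities are counts in the list of linear factors. Members of [cs] that are not roots
    contribute 0. *)
Lemma size_mup (K : closedFieldType) (W : {poly K}) (cs : seq K) : W != 0 -> uniq cs ->
  (forall z, root W z -> z \in cs) -> size W = (\sum_(c <- cs) mup c W).+1.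
Proof.
move=> W0 ucs h; have [s sE] := closed_field_poly_normal W.
have l0 : lead_coef W != 0 by rewrite lead_coef_eq0.
have mE c : mup c W = count_mem c s.
  rewrite sE -mul_polyC mupMr ?mu_prod_XsubC //.
  by rewrite rootC.
have sW : size W = (size s).+1 by rewrite sE size_scale // size_prod_XsubC.
have scs : {subset s <= cs}.
  by move=> z zs; apply: h; rewrite sE rootZ // root_prod_XsubC.
rewrite sW; congr S; rewrite (eq_bigr _ (fun c _ => mE c)).
elim: s {sE sW mE} scs => [_|x s IH scs]; first by rewrite big1.
rewrite /= big_split /= -IH => [|z zs]; last by apply: scs; rewrite inE zs orbT.
rewrite (big_rem x) ?scs ?mem_head //= eqxx big1_seq ?addn0 ?add1n // => c /andP[_ cr].
by case: eqP => // e; move: cr; rewrite -e mem_rem_uniqF.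
Qed.

(** * Normal forms of bicritical maps *)

Lemma size_XnC (K : nzRingType) n (a b : K) :
  (size (a *: 'X^n + b%:P)%R <= n.+1)%N.
Proof.
rewrite (leq_trans (size_polyD _ _)) // geq_max.
rewrite (leq_trans (size_scale_leq _ _)) ?size_polyXn //.
by rewrite (leq_trans (size_polyC_leq1 _)).
Qed.

Lemma normal_exists (R : realType) n (a b c d : Cx R) : (0 < n)%N ->
  a * d - b * c != 0 -> exists g : ratmap R n,
  rnum g = a *: 'X^n + b%:P /\ rden g = c *: 'X^n + d%:P.
Proof.
move=> n0 D0; apply: ratmap_exists; rewrite ?size_XnC // => x y nz.
rewrite !hev_XnC //; apply: nzvec_lin => //.
by rewrite /nzvec !expf_eq0 n0.
Qed.

Definition is_normal (R : realType) n (g : ratmap R n) (a b c d : Cx R) :=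
  [/\ a * d - b * c != 0, rnum g = a *: 'X^n + b%:P & rden g = c *: 'X^n + d%:P].

Lemma reval_normal (R : realType) n (g : ratmap R n) (a b c d x y : Cx R) :
  (0 < n)%N -> is_normal g a b c d -> nzvec x y ->
  reval g (proj x y) = proj (a * x ^+ n + b * y ^+ n) (c * x ^+ n + d * y ^+ n).
Proof. by move=> n0 [_ en ed] nz; rewrite reval_proj // en ed !hev_XnC. Qed.

(** If two combinations of numerator and denominator are n-th powers of independent linear forms L1
    and L2, then f is linear in (L1^n, L2^n), and conjugation by [L1 : L2] gives a normal form. *)
Lemma normal_form_of_powers (R : realType) n (f : ratmap R n)
  (u1 v1 u2 v2 k1 k2 a1 b1 a2 b2 : Cx R) : (0 < n)%N ->
  (forall x y, u1 * hev n (rnum f) x y + v1 * hev n (rden f) x y =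
               k1 * (a1 * x + b1 * y) ^+ n) ->
  (forall x y, u2 * hev n (rnum f) x y + v2 * hev n (rden f) x y =
               k2 * (a2 * x + b2 * y) ^+ n) ->
  k1 != 0 -> k2 != 0 -> a1 * b2 - b1 * a2 != 0 ->
  exists (g : ratmap R n) (a b c d : Cx R), conjugate f g /\ is_normal g a b c d.
Proof.
move=> n0 e1 e2 k10 k20 L0.
(* Were the combinations dependent, their values at the zero (b2, -a2) of L2, where L1 is nonzero,
   would force u2 = v2 = 0; but the second combination is nonzero at (b1, -a1). *)
have D0 : u1 * v2 - v1 * u2 != 0.
  apply/eqP => D0.
  have l20 : k2 * (a2 * b1 + b2 * - a1) ^+ n != 0.
    rewrite mulf_neq0 // expf_neq0 //; move: L0; rewrite -oppr_eq0.
    by congr (_ != 0); ring.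
  have l10 : k1 * (a1 * b2 + b1 * - a2) ^+ n != 0.
    by rewrite mulf_neq0 // expf_neq0 //; move: L0; congr (_ != 0); ring.
  have z2 : a2 * b2 + b2 * - a2 = 0 by ring.
  have := e1 b2 (- a2); have := e2 b2 (- a2); rewrite z2 expr0n gtn_eqF // mulr0.
  set P := hev _ _ _ _; set Q := hev _ _ _ _ => h2 h1.
  have u20 : u2 = 0.
    apply: (mulfI l10); rewrite -h1.
    transitivity (u1 * (u2 * P + v2 * Q) - (u1 * v2 - v1 * u2) * Q); first by ring.
    by rewrite h2 D0; ring.
  have v20 : v2 = 0.
    apply: (mulfI l10); rewrite -h1.
    transitivity (v1 * (u2 * P + v2 * Q) + (u1 * v2 - v1 * u2) * P); first by ring.
    by rewrite h2 D0; ring.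
  by move/eqP: l20; apply; rewrite -e2 u20 v20; ring.
(* Cramer's rule expresses numerator and denominator through L1^n and L2^n, up to the determinant;
   applying [L1 : L2] to the result gives these coefficients. *)
pose a := (a1 * v2 - b1 * u2) * k1; pose b := (b1 * u1 - a1 * v1) * k2.
pose c := (a2 * v2 - b2 * u2) * k1; pose d := (b2 * u1 - a2 * v1) * k2.
have Dg : a * d - b * c != 0.
  have := mulf_neq0 (mulf_neq0 k10 k20) (mulf_neq0 D0 L0).
  by congr (_ != 0); rewrite /a /b /c /d; ring.
have [g [gn gd]] := normal_exists n0 Dg.
have ng : is_normal g a b c d by [].
exists g, a, b, c, d; split=> //.
have [mu muE] := moebius_exists L0; exists mu => p.
have [x [y [nz ->]]] := proj_surj p.
have nz' := nzvec_lin L0 nz; rewrite muE // (reval_normal n0 ng) //.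
rewrite reval_proj // muE; last exact: ratmap_hev.
rewrite -[RHS](proj_scale _ _ D0); congr proj.
  rewrite /a /b -!mulrA -e1 -e2; ring.
rewrite /c /d -!mulrA -e1 -e2; ring.
Qed.

Lemma hev_XsubCX (K : fieldType) n (k c x y : K) :
  hev n (k *: ('X - c%:P) ^+ n) x y = k * (1 * x + - c * y) ^+ n.
Proof.
have sX : size (('X - c%:P) ^+ n) = n.+1 by rewrite size_exp_XsubC.
have -> : k *: ('X - c%:P) ^+ n = k *: ('X - c%:P) ^+ n + 0 *: 0 by rewrite scaler0 addr0.
rewrite hev_lin mul0r addr0; congr (_ * _).
have [->|y0] := eqVneq y 0.
  rewrite hev_coef mulr0 addr0 mul1r -[n in _`_n]/n.+1.-1 -sX -lead_coefE.
  by rewrite (monicP (monic_exp _ (monicXsubC _))) mul1r.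
rewrite hev_affine ?sX // !hornerE -exprMn.
by congr (_ ^+ _); field.
Qed.

Lemma critical_finite (R : realType) n (f : ratmap R n) z :
  critical_points f (Some z) <-> root (wronskian (rnum f) (rden f)) z.
Proof.
have E := local_deriv_eq0 f (Some z).
rewrite /critical_points /=; split=> [/eqP|e]; first by rewrite E.
by apply/eqP; rewrite E.
Qed.

(** The Wronskian of the reversed polynomials, evaluated at 0, involves only the coefficients of
    degree n and n-1. *)
Lemma critical_infinity (R : realType) n (f : ratmap R n) : (0 < n)%N ->
  critical_points f None <->
  (rden f)`_n * (rnum f)`_n.-1 - (rnum f)`_n * (rden f)`_n.-1 = 0.
Proof.
move=> n0.
have -> : (rden f)`_n * (rnum f)`_n.-1 - (rnum f)`_n * (rden f)`_n.-1 =
    ((chart_poly n None (rnum f))^`() * chart_poly n None (rden f) -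
     chart_poly n None (rnum f) * (chart_poly n None (rden f))^`()).[0].
  rewrite hornerD hornerN !hornerM !horner_coef0 !coef_deriv !coef_poly /=.
  by rewrite ltnS n0 subn0 subn1 !mulr1n mulrC.
have E := local_deriv_eq0 f None; rewrite /= in E.
rewrite /critical_points /=; split=> [/eqP|/eqP e]; first by rewrite E => /eqP.
by apply/eqP; rewrite E.
Qed.

Section NormalForm.
Variables (R : realType) (n : nat) (f : ratmap R n).
Hypotheses (n_ge2 : (2 <= n)%N) (bf : bicritical f).
Let p := rnum f.
Let q := rden f.
Let W := wronskian p q.

Let n0 : (0 < n)%N. Proof. exact: leq_trans n_ge2. Qed.
Let sp : (size p <= n.+1)%N. Proof. by have [] := ratmap_size f. Qed.
Let sq : (size q <= n.+1)%N. Proof. by have [] := ratmap_size f. Qed.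

Let critE : exists z c, c <> Some z /\ critical_points f = [set Some z; c].
Proof.
have [[z1|] [c2 [c12 e]]] := bf; first by exists z1, c2; split=> //; exact: nesym.
case: c2 c12 e => // z2 _ e; exists z2, None; split=> //.
by rewrite e setUC.
Qed.

(** A zero Wronskian would make every finite point critical, in particular the three points z, z+1
    and z+2. *)
Let W0 : W != 0.
Proof.
have [z [c [_ e]]] := critE; apply/eqP => w0.
have h w : Some w = Some z \/ Some w = c.
  have : critical_points f (Some w) by apply/critical_finite; rewrite -/p -/q -/W w0 root0.
  by rewrite e.
have n1 (k : nat) : (0 < k)%N -> z + k%:R != z.
  by move=> k0; rewrite -subr_eq0 addrAC subrr add0r pnatr_eq0 -lt0n.
have [[/eqP]|e1] := h (z + 1); first by rewrite (negPf (n1 1%N isT)).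
have [[/eqP]|e2] := h (z + 2); first by rewrite (negPf (n1 2%N isT)).
by move: e1; rewrite -e2 => -[/addrI/eqP]; rewrite (@eqr_nat _ 1 2).
Qed.

Let nzz z : nzvec p.[z] q.[z].
Proof. exact: (coprimep_nzvec (C := Cx R) _ _).1 (rcoprime f) z. Qed.

Lemma bicritical_normal_form :
  exists (g : ratmap R n) (a b c d : Cx R), conjugate f g /\ is_normal g a b c d.
Proof.
have [z [c [cz cE]]] := critE.
have powE w k : q.[w] *: p - p.[w] *: q = k *: ('X - w%:P) ^+ n ->
    forall x y, q.[w] * hev n p x y + (- p.[w]) * hev n q x y = k * (1 * x + - w * y) ^+ n.
  by move=> e x y; rewrite -hev_lin scaleNr e hev_XsubCX.
have [mz zE] := mup_wronskian sp sq W0 (nzz z).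
have [] := size_wronskian sp sq W0 (ratmap_lead f).
set r := _ - _ => srn sW.
have sr0 : (0 < size r)%N by rewrite size_poly_gt0 (comb_neq0 W0 (ratmap_lead f)).
have crit_inf : critical_points f None <-> (size r < n)%N.
  have rn : r`_n.-1 = (rden f)`_n * (rnum f)`_n.-1 - (rnum f)`_n * (rden f)`_n.-1.
    by rewrite /r coefB !coefZ.
  rewrite critical_infinity // -rn; split=> [e|lt]; last by rewrite nth_default // -ltnS prednK.
  rewrite -(prednK n0) ltnS; apply/leq_sizeP => j; rewrite leq_eqVlt => /orP[/eqP <- //|lj].
  by rewrite nth_default // (leq_trans srn) // -(prednK n0).
case: c cz cE => [w|_] cE.
  move=> cE'; have wz : z != w by apply/eqP => e; apply: cE; rewrite e.
  have rootW x : root W x -> x \in [:: z; w].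
    by move/critical_finite; rewrite cE' !inE => -[[->]|[->]]; rewrite eqxx ?orbT.
  have [mw wE] := mup_wronskian sp sq W0 (nzz w).
  have srnE : size r = n.
    apply/eqP; rewrite eqn_leq srn leqNgt; apply/negP => /crit_inf; rewrite cE'.
    by case.
  have := size_mup W0 _ rootW; rewrite /= inE wz => /(_ isT).
  rewrite big_cons big_seq1 => sWE.
  (* Infinity is not critical, so the Wronskian has degree 2n-2. Each of the two multiplicities is
     below n, hence both are n-1 and both points are totally ramified. *)
  have sum : (mup z W + mup w W).+2 = (n + n)%N by rewrite -sWE sW srnE.
  rewrite -/W in mz zE mw wE.
  have [|k1 [k10 e1]] := zE; first by lia.
  have [|k2 [k20 e2]] := wE; first by lia.
  apply: (normal_form_of_powers n0 (powE _ _ e1) (powE _ _ e2) k10 k20).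
  by rewrite !mulr1 mul1r opprK addrC subr_eq0.
have rootW x : root W x -> x \in [:: z].
  by move/critical_finite; rewrite cE !inE => -[[->]|//].
have := size_mup W0 (_ : uniq [:: z]) rootW; rewrite big_seq1 => /(_ isT) => sWE.
(* Now infinity is the second critical point. Since the multiplicity at z is below n and [r] is
   nonzero, this count forces multiplicity n-1 and a constant [r], which homogenizes to a multiple
   of y^n. *)
have {}sW : (mup z W).+2 = (size r + n)%N by rewrite -sW -/W sWE.
have [|k1 [k10 e1]] := zE; first by rewrite -ltnS [X in (_ < X)%N]sW -add1n leq_add2r.
have /eqP/size_poly1P[k2 k20 rE] : size r = 1%N.
  apply/eqP; rewrite eqn_leq sr0 andbT -(leq_add2r n) -sW add1n !ltnS.
  exact: mz.
have e2 x y : q`_n * hev n p x y + (- p`_n) * hev n q x y = k2 * (0 * x + 1 * y) ^+ n.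
  rewrite -hev_lin scaleNr -/r rE mul0r add0r mul1r.
  by rewrite -[k2%:P]add0r -(scale0r 'X^n) hev_XnC // mul0r add0r.
apply: (normal_form_of_powers n0 (powE _ _ e1) e2 k10 k20).
by rewrite mulr0 subr0 mulr1 oner_eq0.
Qed.

End NormalForm.

(** * Symmetric functions of the multipliers *)

Lemma elem_sym_pred (R : realType) n (s : seq (Cx R)) : size s = n.+1 ->
  elem_sym n s = \sum_(j < n.+1) \prod_(i < n.+1 | i != j) s`_i.
Proof.
move=> ss; rewrite /elem_sym ss.
rewrite (reindex_inj (@finset.setC_inj _)) /= (eq_bigl (fun I : {set 'I_n.+1} => #|I| == 1%N)); last first.
  by move=> I; rewrite -(eqn_add2l #|I|) cardsC card_ord -[X in X == _]add1n eqn_add2r eq_sym.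
rewrite (reindex (fun j : 'I_n.+1 => [set j]%SET)); last first.
  exists (fun I : {set 'I_n.+1} => odflt ord0 [pick j in I]) => [j _|I].
    case: pickP => [k|/(_ j)]; first by rewrite inE => /eqP.
    by rewrite inE eqxx.
  rewrite inE => /cards1P[j ->].
  case: pickP => [k|/(_ j)]; first by rewrite inE => /eqP ->.
  by rewrite inE eqxx.
apply: eq_big => [j|j _]; first by rewrite cards1 eqxx.
by apply: eq_bigl => i; rewrite !inE.
Qed.

Lemma elem_sym_inv (R : realType) n (s : seq (Cx R)) : size s = n.+1 ->
  (forall x, x \in s -> x != 0) ->
  elem_sym n s = \prod_(x <- s) x * \sum_(x <- s) x^-1.
Proof.
move=> ss s0; rewrite elem_sym_pred //.
have -> : \prod_(x <- s) x = \prod_(i < n.+1) s`_i by rewrite (big_nth 0) big_mkord ss.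
have -> : \sum_(x <- s) x^-1 = \sum_(i < n.+1) (s`_i)^-1.
  by rewrite (big_nth 0) big_mkord ss.
rewrite mulr_sumr.
apply: eq_bigr => j _; rewrite [in RHS](bigD1 j) //= mulrAC mulfV ?mul1r //.
by apply: s0; rewrite mem_nth // ss.
Qed.

(** Only the subset that omits the zero entry contributes. *)
Lemma elem_sym_rcons0 (R : realType) (s : seq (Cx R)) :
  elem_sym (size s) (rcons s 0) = \prod_(x <- s) x.
Proof.
rewrite elem_sym_pred ?size_rcons // big_ord_recr /= big1 ?add0r => [|j _].
  rewrite big_mkcond big_ord_recr /= eqxx mulr1 (big_nth 0) big_mkord.
  apply: eq_bigr => i _; rewrite -val_eqE /= neq_ltn ltn_ord.
  by rewrite nth_rcons ltn_ord.
rewrite (bigD1 ord_max) /=; last by rewrite -val_eqE /= neq_ltn ltn_ord orbT.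
by rewrite nth_rcons ltnn eqxx mul0r.
Qed.

Lemma log_deriv_prod (K : fieldType) (s : seq K) x : x \notin s ->
  (\prod_(z <- s) ('X - z%:P))^`().[x] =
  (\prod_(z <- s) ('X - z%:P)).[x] * \sum_(z <- s) (x - z)^-1.
Proof.
elim: s => [_|z s IH]; first by rewrite !big_nil derivC horner0 mulr0.
rewrite inE negb_or => /andP[xz xs]; rewrite !big_cons derivM derivXsubC mul1r.
rewrite !(hornerD, hornerM, hornerX, hornerN, hornerC) IH //; have xz0 : x - z != 0 by rewrite subr_eq0.
by field.
Qed.

Lemma prod_horner (K : fieldType) (s : seq K) x :
  (\prod_(z <- s) ('X - z%:P)).[x] = \prod_(z <- s) (x - z).
Proof. by rewrite horner_prod; apply: eq_bigr => z _; rewrite !hornerE. Qed.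

Section FiniteFixedPoints.
Variables (K : numClosedFieldType) (n m : nat) (a b c d : K) (s : seq K).
Hypothesis nE : n = m.+1.
Let D := a * d - b * c.
Let Psi : {poly K} := 'X * (c *: 'X^n + d%:P) - (a *: 'X^n + b%:P).
Hypotheses (b0 : b != 0) (c0 : c != 0) (D0 : D != 0).
Hypothesis PsiE : Psi = c *: \prod_(z <- s) ('X - z%:P).

Let exprn (x : K) : x ^+ n = x * x ^+ m. Proof. by rewrite nE exprS. Qed.

Let n_neq0 : n%:R != 0 :> K. Proof. by rewrite nE pnatr_eq0. Qed.

(** The derivative of (az^n+b)/(cz^n+d) at z, with m = n-1. *)
Let lam z := n%:R * D * z ^+ m / (c * z ^+ n + d) ^+ 2.

Let Psi_eval x : c * \prod_(z <- s) (x - z) = x * (c * x ^+ n + d) - (a * x ^+ n + b).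
Proof. by rewrite -prod_horner -hornerZ -PsiE /Psi !hornerE. Qed.

(** The logarithmic derivative Psi'/Psi, computed once from the linear factors and once from the
    coefficients. *)
Let sum_inv x : x * (c * x ^+ n + d) - (a * x ^+ n + b) != 0 ->
  \sum_(z <- s) (x - z)^-1 = (n.+1%:R * c * x ^+ n + d - n%:R * a * x ^+ m) /
    (x * (c * x ^+ n + d) - (a * x ^+ n + b)).
Proof.
move=> P0; have xs : x \notin s.
  apply: contra_neqN P0 => xs; rewrite -Psi_eval (big_rem x) //= subrr.
  by rewrite mul0r mulr0.
have := log_deriv_prod xs; rewrite prod_horner => /(congr1 ( *%R c)).
rewrite mulrA Psi_eval -hornerZ -derivZ -PsiE /Psi !poly.derivE !hornerE /=.
move=> e; apply: (mulfI P0); rewrite -e [RHS]mulrCA mulfV // mulr1.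
have -> : n.-1 = m by rewrite nE.
rewrite hornerMn hornerXn -(mulr_natl (x ^+ m) n) -(natr1 n) !exprn.
move: (x ^+ m) => X; ring.
Qed.

Let fixed_root z : z \in s -> z * (c * z ^+ n + d) = a * z ^+ n + b.
Proof.
move=> zs; apply/eqP; rewrite -subr_eq0 -Psi_eval (big_rem z) //= subrr.
by rewrite mul0r mulr0.
Qed.

Let fixed_neq0 z : z \in s -> z != 0.
Proof.
move=> /fixed_root; apply: contra_eq_neq => ->.
by rewrite exprn !(mulr0, mul0r) add0r eq_sym.
Qed.

(** The fixed point equation gives (cz^n+d)(a-cz) = D and dz-b = z^n (a-cz). These remove z^n from
    the multiplier and split its inverse into partial fractions in z. *)
Let lamE z : z \in s -> [/\ a - c * z != 0, d * z - b != 0,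
  lam z = n%:R / D * z ^+ m * (a - c * z) ^+ 2 &
  (lam z)^-1 = (a / (a - c * z) + b / (d * z - b)) / n%:R].
Proof.
move=> zs; have z0 := fixed_neq0 zs; have e := fixed_root zs.
have uD : (c * z ^+ n + d) * (a - c * z) = D.
  transitivity (a * (c * z ^+ n + d) - c * (z * (c * z ^+ n + d))); first by ring.
  by rewrite e /D; ring.
have az : a - c * z != 0 by apply: contra_neq D0 => az; rewrite -uD az mulr0.
have u0 : c * z ^+ n + d != 0 by apply: contra_neq D0 => u0; rewrite -uD u0 mul0r.
have dzE : d * z - b = z ^+ n * (a - c * z).
  transitivity (z * (c * z ^+ n + d) - c * z * z ^+ n - b); first by ring.
  by rewrite e; ring.
have dz : d * z - b != 0 by rewrite dzE mulf_neq0 // expf_neq0.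
have zm : z ^+ m != 0 by rewrite expf_neq0.
have uE : c * z ^+ n + d = D / (a - c * z) by rewrite -uD mulfK.
have lE : lam z = n%:R / D * z ^+ m * (a - c * z) ^+ 2.
  by rewrite /lam uE; field; rewrite D0 az.
split=> //; rewrite lE.
have -> : a / (a - c * z) + b / (d * z - b) = D * z / ((a - c * z) * (d * z - b)).
  by rewrite /D; field; rewrite dz az.
rewrite dzE exprn; field; by rewrite z0 zm az D0 n_neq0.
Qed.

Lemma fixed_multiplier_neq0 z : z \in s -> lam z != 0.
Proof.
move=> zs; have [az _ -> _] := lamE zs.
rewrite !mulf_neq0 ?expf_neq0 ?invr_eq0 ?n_neq0 //.
exact: fixed_neq0.
Qed.

Hypothesis ss : size s = n.+1.

(** Psi evaluated at 0 and at a/c yields the products of -z and of a-cz over the fixed points. *)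
Lemma prod_multipliers :
  \prod_(z <- s) lam z = n%:R ^+ n.+1 * (b * c / D) ^+ m.
Proof.
have [k kE] : exists k : K, k = (-1) ^+ m * (n%:R / D) by eexists.
rewrite (eq_big_seq (fun z => k * (0 - z) ^+ m * (a - c * z) ^+ 2)) => [|z zs]; last first.
  have [_ _ -> _] := lamE zs; rewrite kE sub0r (exprNn z).
  have SS : (-1) ^+ m * (-1) ^+ m = 1 :> K by rewrite -expr2 sqrr_sign.
  rewrite -[LHS]mul1r -[X in X * _]SS; ring.
rewrite !big_split /= !prodrXl big_const_seq count_predT ss iter_mulr_1.
have P0 : \prod_(z <- s) (0 - z) = - b / c.
  by apply: (mulfI c0); rewrite Psi_eval exprn; field.
have Pt : \prod_(z <- s) (a - c * z) = c ^+ m * D.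
  have -> : \prod_(z <- s) (a - c * z) = c ^+ n.+1 * \prod_(z <- s) (a / c - z).
    rewrite -ss -iter_mulr_1 -count_predT -big_const_seq -big_split /=.
    by apply: eq_bigr => z _; field.
  rewrite exprSr -mulrA Psi_eval /D !exprn expr_div_n.
  by field; rewrite expf_neq0.
have bcm : (- b / c) ^+ m = (-1) ^+ m * (b ^+ m / c ^+ m).
  by rewrite mulNr (exprNn (b / c)) expr_div_n.
rewrite P0 Pt bcm kE !(expr_div_n, exprMn).
(* The total exponent of the sign is m(n+1) + m = m(m+3), an even number. *)
have sg : (-1) ^+ m ^+ n.+1 * (-1) ^+ m = 1 :> K.
  rewrite -!exprM -exprD -signr_odd nE (_ : odd _ = false) //.
  by rewrite oddD oddM /=; case: (odd m).
have cm : c ^+ m != 0 by rewrite expf_neq0.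
have Dm : D ^+ m != 0 by rewrite expf_neq0.
transitivity ((-1) ^+ m ^+ n.+1 * (-1) ^+ m * (n%:R ^+ n.+1 * (b ^+ m * c ^+ m / D ^+ m))).
     rewrite (exprS D) (exprn D).
  move: ((-1) ^+ m ^+ n.+1 : K) ((-1) ^+ m : K) (n%:R ^+ n.+1 : K) (b ^+ m) => S S' N B.
  by field; rewrite D0 Dm cm.
by rewrite sg mul1r.
Qed.

(** Up to constant factors, the two partial fractions sum to the logarithmic derivative of Psi at
    a/c and at b/d. *)
Lemma sum_inv_multipliers : \sum_(z <- s) (lam z)^-1 =
  (a * (a * (a / c) ^+ m + d) / D + d * (d * (d / b) ^+ m + a) / D - n.+1%:R) / n%:R.
Proof.
rewrite (eq_big_seq (fun z => (a / (a - c * z) + b / (d * z - b)) / n%:R)) => [|z zs]; last first.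
  by have [_ _ _ ->] := lamE zs.
rewrite -mulr_suml big_split /= -addrA; congr ((_ + _) / _).
  rewrite (eq_big_seq (fun z => a / c * (a / c - z)^-1)) => [|z zs]; last first.
    have [az _ _ _] := lamE zs; have -> : a / c - z = (a - c * z) / c by field.
    by field; rewrite az c0.
  have Pt : a / c * (c * (a / c) ^+ n + d) - (a * (a / c) ^+ n + b) = D / c.
    by rewrite /D exprn; field.
  rewrite -mulr_sumr sum_inv Pt ?mulf_neq0 ?invr_eq0 //.
  rewrite !exprn -(natr1 n); move: ((a / c) ^+ m) => T; field.
  by rewrite D0 c0.
(* For d = 0 the point b/d is missing, but each of the n+1 second fractions is simply -1. *)
have [d0|d0] := eqVneq d 0.
  rewrite (eq_bigr (fun=> -1)) => [|z _]; last first.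
    by rewrite d0 mul0r sub0r invrN mulrN divff.
  by rewrite big_const_seq count_predT ss iter_addr_0 d0 !mul0r add0r mulNrn.
rewrite (eq_big_seq (fun z => - (b / d) * (b / d - z)^-1)) => [|z zs]; last first.
  have [_ dz _ _] := lamE zs; have -> : b / d - z = - (d * z - b) / d by field.
  by field; rewrite dz d0.
have tm : (b / d) ^+ m != 0 by rewrite expf_neq0 // mulf_neq0 ?invr_eq0.
have Pt : b / d * (c * (b / d) ^+ n + d) - (a * (b / d) ^+ n + b) = - (b / d) ^+ n * D / d.
  by rewrite /D exprn; field.
rewrite -mulr_sumr sum_inv Pt; last first.
  by rewrite mulf_neq0 ?invr_eq0 // mulf_neq0 // oppr_eq0 expf_neq0 // mulf_neq0 ?invr_eq0.
have -> : d / b = (b / d)^-1 by rewrite invf_div.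
rewrite exprVn !exprn -(natr1 n).
move: D0 tm; rewrite /D; move: ((b / d) ^+ m) => T D1 T0; field.
by rewrite D1 T0 d0 b0.
Qed.

End FiniteFixedPoints.

(** * The invariants X, Y and sigma_n of a normal form *)

Definition normX (K : fieldType) (a b c d : K) := b * c / (a * d - b * c).

Definition normY (K : fieldType) n (a b c d : K) :=
  (a ^+ n.+1 * b ^+ n.-1 + c ^+ n.-1 * d ^+ n.+1) / (a * d - b * c) ^+ n.

Lemma normX_swap (K : fieldType) (a b c d : K) : normX d c b a = normX a b c d.
Proof. by rewrite /normX [c * b]mulrC [d * a]mulrC. Qed.

Lemma normY_swap (K : fieldType) n (a b c d : K) : normY n d c b a = normY n a b c d.
Proof.
rewrite /normY [c * b]mulrC [d * a]mulrC addrC.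
by rewrite [b ^+ _ * _]mulrC [d ^+ _ * _]mulrC.
Qed.

Definition norm_sigma (K : fieldType) n (X Y : K) :=
  n%:R ^+ n * (Y + (2 * X + 1 - n%:R) * X ^+ n.-1).

Lemma normal_swap (R : realType) n (g : ratmap R n) (a b c d : Cx R) :
  (0 < n)%N -> is_normal g a b c d ->
  exists h : ratmap R n, conjugate g h /\ is_normal h d c b a.
Proof.
move=> n0 ng; have [D0 _ _] := ng.
have D1 : d * a - c * b != 0 by rewrite mulrC [c * b]mulrC.
have [h [hn hd]] := normal_exists n0 D1; have nh : is_normal h d c b a by [].
exists h; split=> //.
(* Conjugation by z -> 1/z. *)
have D2 : 0 * 0 - 1 * 1 != 0 :> Cx R by rewrite mul0r mulr1 sub0r oppr_eq0 oner_eq0.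
have [mu muE] := moebius_exists D2; exists mu => p.
have [x [y [nz ->]]] := proj_surj p.
rewrite muE // (reval_normal n0 nh); last exact: nzvec_lin.
rewrite (reval_normal n0 ng) // muE; last first.
  by apply: nzvec_lin => //; rewrite /nzvec !expf_eq0 n0.
by rewrite !mul0r !mul1r !add0r !addr0 addrC [a * _ + _]addrC.
Qed.

(** Conjugation by z -> lz. The four equations compare homogeneous coordinates of both sides, and k
    is the free projective factor. *)
Lemma normal_scale (R : realType) n (g h : ratmap R n)
    (a b c d a' b' c' d' l k : Cx R) : (0 < n)%N ->
  is_normal g a b c d -> is_normal h a' b' c' d' -> l != 0 -> k != 0 ->
  a' * l ^+ n = k * l * a -> b' = k * l * b -> c' * l ^+ n = k * c -> d' = k * d ->
  conjugate g h.
Proof.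
move=> n0 ng nh l0 k0 ea eb ec ed; have [D0 _ _] := ng.
have D2 : l * 1 - 0 * 0 != 0 by rewrite mul0r mulr1 subr0.
have [mu muE] := moebius_exists D2; exists mu => p.
have [x [y [nz ->]]] := proj_surj p.
rewrite muE // (reval_normal n0 nh); last exact: nzvec_lin.
rewrite (reval_normal n0 ng) // muE; last first.
  by apply: nzvec_lin => //; rewrite /nzvec !expf_eq0 n0.
rewrite -[RHS](proj_scale _ _ k0) !mul0r !mul1r addr0 add0r exprMn !mulrA ea ec eb ed.
by congr proj; ring.
Qed.

Lemma fixed_points_split (R : realType) n (f : ratmap R n) : (2 <= n)%N ->
  exists s : seq (Cx R), let Phi := rnum f - 'X * rden f in
    [/\ fixed_points f = map Some s ++ nseq (n.+1 - size s) None,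
        Phi = lead_coef Phi *: \prod_(z <- s) ('X - z%:P) &
        size Phi = (size s).+1].
Proof.
move=> n2; rewrite /fixed_points; case: closed_field_poly_normal => s /= sE.
exists s; split=> //.
by rewrite {1}sE size_scale ?lead_coef_eq0 ?fixed_poly_neq0 // size_prod_XsubC.
Qed.

Lemma lead_coef_size (K : nzRingType) (p : {poly K}) k : p`_k != 0 ->
  (forall j, (k < j)%N -> p`_j = 0) -> size p = k.+1 /\ lead_coef p = p`_k.
Proof.
move=> pk pj; have sE : size p = k.+1.
  apply/eqP; rewrite eqn_leq; apply/andP; split; first exact/leq_sizeP.
  by rewrite ltnNge; apply: contra pk => le; rewrite nth_default.
by rewrite lead_coefE sE.
Qed.

Lemma multiplier_normal (R : realType) n (f : ratmap R n) (a b c d z : Cx R) :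
  is_normal f a b c d -> reval f (Some z) = Some z ->
  c * z ^+ n + d != 0 /\ local_deriv (reval f) (Some z) =
    n%:R * (a * d - b * c) * z ^+ n.-1 / (c * z ^+ n + d) ^+ 2.
Proof.
move=> [D0 en ed] fz.
have hE (u v : Cx R) : (u *: 'X^n + v%:P).[z] = u * z ^+ n + v by rewrite !hornerE.
have hdE (u v : Cx R) : (u *: 'X^n + v%:P)^`().[z] = u * (n%:R * z ^+ n.-1).
  by rewrite derivD derivZ derivXn derivC addr0 hornerZ hornerMn hornerXn mulr_natl.
have q0 : c * z ^+ n + d != 0 by move: fz => /=; rewrite ed hE; case: eqP.
split=> //; apply: etrans (local_derivE f (Some z)) _.
rewrite /= en ed !hdE !hE (negPf q0); congr (_ / _).
ring.
Qed.

Lemma sigma_normal_generic (K : fieldType) n m (a b c d N : K) : n = m.+1 ->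
  let D := a * d - b * c in D != 0 -> b != 0 -> c != 0 -> N != 0 ->
  N ^+ n.+1 * (b * c / D) ^+ m *
   ((a * (a * (a / c) ^+ m + d) / D + d * (d * (d / b) ^+ m + a) / D - (N + 1)) / N) =
  N ^+ n * ((a ^+ n.+1 * b ^+ m + c ^+ m * d ^+ n.+1) / D ^+ n +
    (2 * (b * c / D) + 1 - N) * (b * c / D) ^+ m).
Proof.
move=> nE D D0 b0 c0 N0.
have exprn (x : K) : x ^+ n = x * x ^+ m by rewrite nE exprS.
have := expf_neq0 m b0; have := expf_neq0 m c0; have := expf_neq0 m D0.
rewrite (exprS N) (exprS a) (exprS d) (exprn a) (exprn d) (exprn D) !expr_div_n exprMn.
move: (N ^+ n) (a ^+ m) (b ^+ m) (c ^+ m) (d ^+ m) (D ^+ m) D0 => Nn A B C E F.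
rewrite /D => D0 F0 C0 B0; field.
by rewrite N0 D0 F0 C0 B0.
Qed.

Section SigmaNormal.
Variables (R : realType) (n : nat) (f : ratmap R n) (a b c d : Cx R).
Hypotheses (n_ge2 : (2 <= n)%N) (nf : is_normal f a b c d).
Let D := a * d - b * c.
Let n0 : (0 < n)%N. Proof. exact: leq_trans n_ge2. Qed.
Let nE : n = n.-1.+1. Proof. by rewrite prednK. Qed.
Let Phi := rnum f - 'X * rden f.
Let PhiE : Phi = (a *: 'X^n + b%:P) - 'X * (c *: 'X^n + d%:P).
Proof. by rewrite /Phi; have [_ -> ->] := nf. Qed.
Let PhiS k : Phi`_k.+1 = (if k.+1 == n then a else 0) -
  ((if k == n then c else 0) + (if k == 0%N then d else 0)).
Proof.
rewrite PhiE coefB mulrC coefMX /= !coefD !coefZ !coefXn !coefC /= addr0.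
by congr (_ - (_ + _)); case: eqP; rewrite ?mulr1 ?mulr0.
Qed.

(** With c nonzero the fixed point polynomial has full degree n+1, and with b nonzero 0 is not
    fixed. So all fixed points are finite with nonzero multipliers, and sigma_n is their product
    times the sum of their inverses. *)
Lemma sigma_normal_finite : b != 0 -> c != 0 ->
  sigma n f = norm_sigma n (normX a b c d) (normY n a b c d).
Proof.
move=> b0 c0; have [D0 _ _] := nf.
have [s [fE]] := fixed_points_split f n_ge2; rewrite -/Phi => sE sPhi.
have [||sz lc] := @lead_coef_size _ Phi n.+1.
- by rewrite PhiS gtn_eqF // eqxx gtn_eqF // addr0 sub0r oppr_eq0.
- move=> [//|j] lj; rewrite PhiS; do 3 (case: eqP => [|_]; first by lia).
  by rewrite addr0 subr0.
have ss : size s = n.+1 by move: sPhi; rewrite sz => -[].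
move: fE; rewrite ss subnn cats0 => fE.
have PsiE : 'X * (c *: 'X^n + d%:P) - (a *: 'X^n + b%:P) = c *: \prod_(z <- s) ('X - z%:P).
  rewrite -opprB -PhiE sE lc PhiS gtn_eqF // eqxx gtn_eqF // addr0 sub0r.
  by rewrite scaleNr opprK.
have mE : multipliers f = [seq n%:R * D * z ^+ n.-1 / (c * z ^+ n + d) ^+ 2 | z <- s].
  rewrite /multipliers fE -map_comp; apply/eq_in_map => z zs /=.
  apply: (multiplier_normal nf _).2; apply/mem_fixed_points => //.
  by rewrite fE map_f.
rewrite /sigma mE elem_sym_inv ?size_map // => [|_ /mapP[z zs ->]]; last first.
  exact: (fixed_multiplier_neq0 nE b0 D0 PsiE zs).
rewrite !big_map (prod_multipliers nE b0 c0 D0 PsiE ss).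
rewrite (sum_inv_multipliers nE b0 c0 D0 PsiE ss) -(natr1 n).
by apply: sigma_normal_generic => //; rewrite pnatr_eq0 -lt0n.
Qed.

(** Infinity is a simple fixed point and critical, so its multiplier is 0 and sigma_n is the product
    of the n finite multipliers. *)
Lemma sigma_normal_pole : c = 0 ->
  sigma n f = norm_sigma n (normX a b c d) (normY n a b c d).
Proof.
move=> c0; have [D0 en ed] := nf.
have ad0 : a * d != 0 by move: D0; rewrite c0 mulr0 subr0.
have [a0 d0] : a != 0 /\ d != 0 by apply/andP; rewrite -negb_or -mulf_eq0.
have [s [fE]] := fixed_points_split f n_ge2; rewrite -/Phi => sE sPhi.
have Phin : Phi`_n = a.
  rewrite [in LHS]nE PhiS -nE eqxx; do 2 (case: eqP => [|_]; first by lia).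
  by rewrite addr0 subr0.
have [||sz lc] := @lead_coef_size _ Phi n.
- by rewrite Phin.
- move=> [//|j] lj; rewrite PhiS c0 if_same; do 2 (case: eqP => [|_]; first by lia).
  by rewrite addr0 subr0.
have ss : size s = n by move: sPhi; rewrite sz => -[].
move: fE; rewrite ss subSnn => fE.
have infty : local_deriv (reval f) None = 0.
  apply/critical_infinity => //; rewrite en ed c0 scale0r add0r !coefC.
  by rewrite gtn_eqF // gtn_eqF ?mul0r ?mulr0 ?subr0 // -ltnS prednK.
have mE : multipliers f = rcons [seq n%:R * a / d * z ^+ n.-1 | z <- s] 0.
  rewrite /multipliers fE map_cat -map_comp /= infty cats1; congr rcons.
  apply/eq_in_map => z zs /=.
  have [|_ ->] := multiplier_normal nf (_ : reval f (Some z) = Some z).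
    by apply/mem_fixed_points => //; rewrite fE mem_cat map_f.
  by rewrite c0 mul0r add0r mulr0 subr0; field.
have := elem_sym_rcons0 [seq n%:R * a / d * z ^+ n.-1 | z <- s].
rewrite size_map ss -mE -/(sigma n f) big_map => ->.
have [k kE] : exists k, k = n%:R * a / d by eexists.
have P0 : (-1) ^+ n * \prod_(z <- s) z = b / a.
  have -> : (-1) ^+ n * \prod_(z <- s) z = \prod_(z <- s) (0 - z).
    rewrite -{1}ss -count_predT -iter_mulr_1 -big_const_seq -big_split /=.
    by apply: eq_bigr => z _; rewrite mulN1r sub0r.
  have Phi0 : Phi.[0] = b.
    by rewrite PhiE !(hornerD, hornerN, hornerM, hornerZ, hornerXn, hornerX, hornerC) mul0r subr0 nE exprS !(mul0r, mulr0) add0r.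
  apply: (mulfI a0); rewrite -prod_horner [RHS]mulrC divfK // -[RHS]Phi0 [in RHS]sE.
  by rewrite hornerZ lc Phin.
rewrite -kE big_split /= prodrXl big_const_seq count_predT ss iter_mulr_1.
(* The sign (-1)^n disappears because n(n-1) is even. *)
have -> : (\prod_(i <- s) i) ^+ n.-1 = (b / a) ^+ n.-1.
  rewrite -P0 exprMn -exprM -signr_odd (_ : odd _ = false) ?mul1r //.
  by rewrite [in (n * _)%N]nE oddM /=; case: (odd _).
rewrite /norm_sigma /normX /normY kE c0 !mulr0 mul0r !subr0.
have -> : 0 ^+ n.-1 = 0 :> Cx R by rewrite expr0n gtn_eqF // -ltnS prednK.
rewrite mul0r mulr0 !addr0 !(expr_div_n, exprMn) exprS.
have aE : a ^+ n = a * a ^+ n.-1 by rewrite [in LHS]nE exprS.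
have := expf_neq0 n.-1 a0; have := expf_neq0 n d0; rewrite aE.
by move=> h1 h2; field; rewrite h1 h2 a0.
Qed.

End SigmaNormal.

Lemma sigma_normal (R : realType) n (f : ratmap R n) (a b c d : Cx R) :
  (2 <= n)%N -> is_normal f a b c d ->
  sigma n f = norm_sigma n (normX a b c d) (normY n a b c d).
Proof.
move=> n2 nf; have n0 : (0 < n)%N by apply: leq_trans n2.
have [c0|c0] := eqVneq c 0; first exact: sigma_normal_pole nf c0.
have [b0|b0] := eqVneq b 0; last exact: sigma_normal_finite nf b0 c0.
have [h [gh nh]] := normal_swap n0 nf.
apply: etrans (esym (sigma_conj n n2 gh)) _.
apply: etrans (sigma_normal_pole n2 nh b0) _.
by rewrite normX_swap normY_swap.
Qed.

(** * Classification of normal forms *)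

Lemma critical_normal (R : realType) n (f : ratmap R n) (a b c d : Cx R) :
  (2 <= n)%N -> is_normal f a b c d -> critical_points f = [set Some 0; None].
Proof.
move=> n2 nf; have [D0 en ed] := nf; have n0 : (0 < n)%N by apply: leq_trans n2.
have WE : wronskian (rnum f) (rden f) = (n%:R * (a * d - b * c)) *: 'X^(n.-1).
  have dX : ('X^n : {poly Cx R})^`() = n%:R%:P * 'X^(n.-1).
    by rewrite derivXn -mulr_natl polyC_natr.
  rewrite /wronskian en ed !derivD !derivZ !derivC !addr0 dX -!mul_polyC.
  by rewrite !rmorphM rmorphB !rmorphM /=; move: (n%:R%:P) => N; ring.
have rootE z : root (wronskian (rnum f) (rden f)) z = (z == 0).
  rewrite WE rootZ ?mulf_neq0 ?pnatr_eq0 -?lt0n // rootE hornerXn expf_eq0.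
  by rewrite -ltnS prednK // n2.
apply/seteqP; split=> [[z|]|_ [->|->]].
- by move/critical_finite; rewrite rootE => /eqP ->; left.
- by right.
- by apply/critical_finite; rewrite rootE.
have c0 (u v : Cx R) : (u *: 'X^n + v%:P)`_n.-1 = 0.
  rewrite coefD coefZ coefXn coefC; do 2 (case: eqP => [|_]; first by lia).
  by rewrite mulr0 addr0.
by apply/critical_infinity => //; rewrite en ed !c0 !mulr0 subr0.
Qed.

Lemma bicritical_normal (R : realType) n (f : ratmap R n) (a b c d : Cx R) :
  (2 <= n)%N -> is_normal f a b c d -> bicritical f.
Proof.
by move=> n2 nf; exists (Some 0), None; split=> //; exact: critical_normal nf.
Qed.

(** A conjugacy permutes the critical points 0 and infinity, so it is z -> kz or z -> k/z. Either
    way, comparing the images of 0 and infinity preserves the ratio of bc to ad, that is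
    f(0)/f(infinity), which determines X. *)
Lemma normX_conj (R : realType) n (f g : ratmap R n) (a b c d a' b' c' d' : Cx R) :
  (2 <= n)%N -> is_normal f a b c d -> is_normal g a' b' c' d' ->
  conjugate f g -> normX a' b' c' d' = normX a b c d.
Proof.
move=> n2 nf ng [mu fg]; have n0 : (0 < n)%N by apply: leq_trans n2.
have [D0 _ _] := nf; have [D0' _ _] := ng.
have [u [v [w [t [M0 muE]]]]] := moebiusP mu.
have z01 : nzvec (0 : Cx R) 1 by rewrite /nzvec oner_eq0 orbT.
have z10 : nzvec (1 : Cx R) 0 by rewrite /nzvec oner_eq0.
have crit (x y : Cx R) : nzvec x y -> proj x y = Some 0 \/ proj x y = None ->
    u * x + v * y = 0 \/ w * x + t * y = 0.
  move=> nz h; have : critical_points g (reval mu (proj x y)).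
    by apply/(critical_conj fg); rewrite (critical_normal n2 nf).
  rewrite (critical_normal n2 ng) muE // /proj.
  case: eqVneq => [|wt0]; first by right.
  by move=> [[/eqP]|//]; rewrite mulf_eq0 invr_eq0 (negPf wt0) orbF => /eqP; left.
have h0 : v = 0 \/ t = 0.
  have := crit 0 1 z01; rewrite /proj oner_eq0 mul0r !mulr0 !mulr1 !add0r.
  by apply; left.
have h1 : u = 0 \/ w = 0.
  have := crit 1 0 z10; rewrite /proj eqxx !mulr0 !mulr1 !addr0.
  by apply; right.
have e0 := fg (proj 0 1); have e1 := fg (proj 1 0).
have f01 : reval f (proj 0 1) = proj b d.
  by rewrite (reval_normal n0 nf) // expr0n gtn_eqF // expr1n !mulr0 !add0r !mulr1.
have f10 : reval f (proj 1 0) = proj a c.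
  by rewrite (reval_normal n0 nf) // expr0n gtn_eqF // expr1n !mulr0 !addr0 !mulr1.
have nbd : nzvec b d.
  by have := nzvec_lin D0 z01; rewrite !mulr0 !mulr1 !add0r.
have nac : nzvec a c.
  by have := nzvec_lin D0 z10; rewrite !mulr0 !mulr1 !addr0.
have key (e : b * c * (a' * d') = b' * c' * (a * d)) : normX a' b' c' d' = normX a b c d.
  rewrite /normX; apply/eqP; rewrite eqr_div //; apply/eqP.
  transitivity (b' * c' * (a * d) - b' * c' * (b * c)); first by ring.
  by rewrite -e; ring.
move: e0 e1; rewrite f01 f10 !muE // !(mulr0, mulr1, add0r, addr0).
have nm (x y : Cx R) := nzvec_lin M0 (x := x) (y := y).
have nv := nzvec_lin M0 z01; have nu := nzvec_lin M0 z10.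
move: nv nu; rewrite !(mulr0, mulr1, add0r, addr0) => nv nu.
rewrite !(reval_normal n0 ng) // => e0 e1.
have {}e0 := (proj_eq (nzvec_lin D0' _) (nm _ _ nbd)).1 e0.
have {}e1 := (proj_eq (nzvec_lin D0' _) (nm _ _ nac)).1 e1.
have pw (x y : Cx R) : nzvec x y -> nzvec (x ^+ n) (y ^+ n).
  by rewrite /nzvec !expf_eq0 n0.
move: (e0 (pw _ _ nv)) (e1 (pw _ _ nu)).
have [v0|t0] := h0.
  have [ut0] : u != 0 /\ t != 0.
    by move: M0; rewrite v0 mul0r subr0 mulf_eq0 negb_or => /andP.
  move=> t0; have w0 : w = 0 by case: h1 => // u0; rewrite u0 eqxx in ut0.
  rewrite v0 w0 expr0n gtn_eqF // !(mulr0, mul0r, add0r, addr0) => E0 E1.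
  have tn : t ^+ n != 0 by rewrite expf_neq0.
  have un : u ^+ n != 0 by rewrite expf_neq0.
  have {}E0 : b' * (t * d) = u * b * d'.
    by apply: (mulfI tn); transitivity (b' * t ^+ n * (t * d)); [ring|rewrite E0; ring].
  have {}E1 : a' * (t * c) = u * a * c'.
    by apply: (mulfI un); transitivity (a' * u ^+ n * (t * c)); [ring|rewrite E1; ring].
  apply: key; apply: (mulfI (mulf_neq0 ut0 t0)).
  transitivity ((u * b * d') * (a' * (t * c))); first by ring.
  by rewrite -E0 E1; ring.
have [v0 w0] : v != 0 /\ w != 0.
  by move: M0; rewrite t0 mulr0 sub0r oppr_eq0 mulf_eq0 negb_or => /andP.
have u0 : u = 0 by case: h1 => // w00; rewrite w00 eqxx in w0.
rewrite u0 t0 expr0n gtn_eqF // !(mulr0, mul0r, add0r, addr0) => E0 E1.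
have vn : v ^+ n != 0 by rewrite expf_neq0.
have wn : w ^+ n != 0 by rewrite expf_neq0.
have {}E0 : a' * (w * b) = v * d * c'.
  by apply: (mulfI vn); transitivity (a' * v ^+ n * (w * b)); [ring|rewrite E0; ring].
have {}E1 : b' * (w * a) = v * c * d'.
  by apply: (mulfI wn); transitivity (b' * w ^+ n * (w * a)); [ring|rewrite E1; ring].
apply: key; apply: (mulfI (mulf_neq0 v0 w0)).
transitivity ((v * c * d') * (a' * (w * b))); first by ring.
by rewrite E0 -E1; ring.
Qed.

(** Multiplying all coefficients by a square root of the inverse determinant does not change the
    map, and X and Y are homogeneous of degree 0. *)
Lemma conj_unimodular (R : realType) n (f : ratmap R n) (a b c d : Cx R) :
  (0 < n)%N -> is_normal f a b c d ->
  exists (h : ratmap R n) (a' b' c' d' : Cx R), [/\ conjugate f h,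
    is_normal h a' b' c' d', a' * d' - b' * c' = 1,
    normX a' b' c' d' = normX a b c d & normY n a' b' c' d' = normY n a b c d].
Proof.
move=> n0 nf; have [D0 _ _] := nf.
have [k kE] : exists k : Cx R, k ^+ 2 = (a * d - b * c)^-1.
  by exists (sqrtC (a * d - b * c)^-1); rewrite sqrtCK.
have k0 : k != 0.
  by apply: contraNneq D0 => k0; move: kE; rewrite k0 expr0n => /esym/eqP; rewrite invr_eq0.
have DE : (k * a) * (k * d) - (k * b) * (k * c) = k ^+ 2 * (a * d - b * c) by ring.
have D1 : (k * a) * (k * d) - (k * b) * (k * c) = 1 by rewrite DE kE mulVf.
have D1' : (k * a) * (k * d) - (k * b) * (k * c) != 0 by rewrite D1 oner_eq0.
have [h [hn hd]] := normal_exists n0 D1'.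
have nh : is_normal h (k * a) (k * b) (k * c) (k * d) by split.
exists h, (k * a), (k * b), (k * c), (k * d); split; [|exact: nh|exact: D1| |].
- by apply: (normal_scale n0 nf nh (oner_neq0 _) k0); rewrite ?expr1n ?mulr1.
- rewrite /normX DE (_ : k * b * (k * c) = k ^+ 2 * (b * c)); last by ring.
  by rewrite -mulf_div divff ?mul1r // expf_neq0.
have [m nE] : exists m, n = m.+1 by exists n.-1; rewrite prednK.
rewrite /normY DE nE /=.
have -> : (k * a) ^+ m.+2 * (k * b) ^+ m + (k * c) ^+ m * (k * d) ^+ m.+2 =
    (k ^+ 2) ^+ m.+1 * (a ^+ m.+2 * b ^+ m + c ^+ m * d ^+ m.+2).
  have kk : (k ^+ 2) ^+ m.+1 = k ^+ m.+2 * k ^+ m.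
    by rewrite -exprM -exprD; congr (_ ^+ _); lia.
  by rewrite kk !exprMn; ring.
by rewrite [(_ * (a * d - _)) ^+ _]exprMn -mulf_div divff ?mul1r // !expf_neq0.
Qed.

Section Classification.
Variables (R : realType) (n : nat).
Hypothesis n_ge2 : (2 <= n)%N.
Let n0 : (0 < n)%N. Proof. exact: leq_trans n_ge2. Qed.
Let m0 : (0 < n.-1)%N. Proof. by rewrite -ltnS prednK. Qed.
Let exprn (x : Cx R) : x ^+ n = x * x ^+ n.-1.
Proof. by rewrite -[in LHS](prednK n0) exprS. Qed.

Lemma conj_of_leading (f g : ratmap R n) (a b c d a' b' c' d' : Cx R) :
  is_normal f a b c d -> is_normal g a' b' c' d' ->
  b * c = b' * c' -> a * d = a' * d' ->
  a ^+ n.+1 * b ^+ n.-1 = a' ^+ n.+1 * b' ^+ n.-1 ->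
  a ^+ n.+1 * b ^+ n.-1 != 0 -> conjugate f g.
Proof.
move=> nf ng ebc ead eP P0.
have P0' := P0; rewrite eP in P0'.
have nz (x y : Cx R) : x ^+ n.+1 * y ^+ n.-1 != 0 -> x != 0 /\ y != 0.
  by rewrite mulf_eq0 !expf_eq0 /= m0 /= negb_or => /andP.
have [a0 b0] := nz _ _ P0; have [a0' b0'] := nz _ _ P0'.
(* The equations of [normal_scale] for d and b force k = d'/d = a/a' and l = a'b'/(ab); equality of
   the leading invariants is what the remaining equations require of l^n. *)
have ln : (a' * b' / (a * b)) ^+ n = a * b' / (a' * b).
  have A0 := expf_neq0 n.-1 a0; have B0 := expf_neq0 n.-1 b0.
  rewrite expr_div_n !exprMn !exprn; apply/eqP.
  rewrite eqr_div ?mulf_neq0 //; apply/eqP.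
  transitivity ((a' ^+ n.+1 * b' ^+ n.-1) * b * b'); first by rewrite exprS exprn; ring.
  by rewrite -eP exprS exprn; ring.
apply: (normal_scale n0 nf ng (l := a' * b' / (a * b)) (k := a / a')).
- by rewrite mulf_neq0 ?invr_eq0 ?mulf_neq0.
- by rewrite mulf_neq0 ?invr_eq0.
- by rewrite ln; field; rewrite a0 b0 a0'.
- by field; rewrite a0 b0 a0'.
- rewrite ln; apply: (mulfI b0); transitivity (a / a' * (b' * c')); first by field; rewrite b0 a0'.
  by rewrite -ebc; ring.
- by apply: (mulfI a0'); rewrite -ead; field.
Qed.

(** A nonzero determinant leaves a = d = 0 or b = c = 0, so both maps are monomials in z^(-n) or
    both in z^n. A root of order n+1, respectively n-1, gives the scale. *)
Lemma conj_of_degenerate (f g : ratmap R n) (a b c d a' b' c' d' : Cx R) :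
  is_normal f a b c d -> is_normal g a' b' c' d' ->
  b * c = b' * c' -> a * d = a' * d' ->
  a ^+ n.+1 * b ^+ n.-1 = 0 -> a' ^+ n.+1 * b' ^+ n.-1 = 0 ->
  c ^+ n.-1 * d ^+ n.+1 = 0 -> c' ^+ n.-1 * d' ^+ n.+1 = 0 -> conjugate f g.
Proof.
move=> nf ng ebc ead.
have z (x y : Cx R) : x ^+ n.+1 * y ^+ n.-1 = 0 -> x = 0 \/ y = 0.
  by move/eqP; rewrite mulf_eq0 !expf_eq0 /= m0 => /orP[] /eqP; [left|right].
move=> /z h1 /z h2; rewrite mulrC => /z h3; rewrite mulrC => /z h4.
have [D0 _ _] := nf; have [D0' _ _] := ng.
have [a0|a0] := eqVneq a 0.
  have bc0 : b * c != 0 by move: D0; rewrite a0 mul0r sub0r oppr_eq0.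
  have bc0' := bc0; rewrite ebc in bc0'.
  have [b0 c0] : b != 0 /\ c != 0 by move: bc0; rewrite mulf_eq0 negb_or => /andP.
  have [b0' c0'] : b' != 0 /\ c' != 0 by move: bc0'; rewrite mulf_eq0 negb_or => /andP.
  have d0 : d = 0 by case: h3 => // e; rewrite e eqxx in c0.
  have a0' : a' = 0 by case: h2 => // e; rewrite e eqxx in b0'.
  have d0' : d' = 0 by case: h4 => // e; rewrite e eqxx in c0'.
  have [l lE] : exists l : Cx R, l ^+ n.+1 = b' * c / (c' * b).
    by exists (n.+1.-root (b' * c / (c' * b))); rewrite rootCK.
  have l0 : l != 0.
    apply/eqP => l0; move/eqP: lE; rewrite l0 expr0n /= eq_sym.
    by rewrite mulf_eq0 invr_eq0 !mulf_eq0 (negPf b0) (negPf c0) (negPf b0') (negPf c0').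
  apply: (normal_scale n0 nf ng (l := l) (k := b' / (l * b))) => //.
  - by rewrite mulf_neq0 ?invr_eq0 ?mulf_neq0.
  - by rewrite a0 a0' mul0r mulr0.
  - by field; rewrite l0 b0.
  - apply: (mulfI l0); transitivity (c' * l ^+ n.+1); first by rewrite exprS; ring.
    by rewrite lE; field; rewrite c0' b0 l0.
  - by rewrite d0 d0' mulr0.
have b0 : b = 0 by case: h1 => // e; rewrite e eqxx in a0.
have d0 : d != 0 by apply: contraNneq D0 => d0; rewrite d0 b0 mulr0 mul0r subr0.
have c0 : c = 0 by case: h3 => // e; rewrite e eqxx in d0.
have ad0' : a' * d' != 0 by rewrite -ead mulf_neq0.
have [a0' d0'] : a' != 0 /\ d' != 0 by move: ad0'; rewrite mulf_eq0 negb_or => /andP.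
have b0' : b' = 0 by case: h2 => // e; rewrite e eqxx in a0'.
have c0' : c' = 0 by case: h4 => // e; rewrite e eqxx in d0'.
have [l lE] : exists l : Cx R, l ^+ n.-1 = d' / d * a / a'.
  by exists (n.-1.-root (d' / d * a / a')); rewrite rootCK.
have l0 : l != 0.
  apply/eqP => l0; move/eqP: lE; rewrite l0 expr0n gtn_eqF // eq_sym.
  by rewrite !mulf_eq0 !invr_eq0 (negPf a0) (negPf d0) (negPf a0') (negPf d0').
apply: (normal_scale n0 nf ng (l := l) (k := d' / d)) => //.
- by rewrite mulf_neq0 ?invr_eq0.
- by rewrite exprn lE; field; rewrite d0 a0'.
- by rewrite b0 b0' mulr0.
- by rewrite c0 c0' mul0r mulr0.
- by field.
Qed.

Lemma conj_of_invariants (f g : ratmap R n) (a b c d a' b' c' d' : Cx R) :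
  is_normal f a b c d -> is_normal g a' b' c' d' ->
  normX a b c d = normX a' b' c' d' -> normY n a b c d = normY n a' b' c' d' ->
  conjugate f g.
Proof.
move=> nf ng.
have [f1 [a1 [b1 [c1 [d1 [ff1 nf1 D1 <- <-]]]]]] := conj_unimodular n0 nf.
have [g1 [a2 [b2 [c2 [d2 [gg1 ng1 D2 <- <-]]]]]] := conj_unimodular n0 ng.
move=> eX eY; apply: (conjugate_trans ff1).
apply: conjugate_trans (conjugate_sym gg1).
move: eX eY; rewrite /normX /normY D1 D2 !expr1n !divr1 => ebc.
have ead : a1 * d1 = a2 * d2.
  by move/eqP: D1; move/eqP: D2; rewrite !subr_eq -ebc => /eqP -> /eqP ->.
have [g2 [gg2 ng2]] := normal_swap n0 ng1.
have [f2 [ff2 nf2]] := normal_swap n0 nf1.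
(* When only the second invariant is nonzero, exchanging 0 and infinity in both maps makes it the
   leading one. *)
have same (h h' : ratmap R n) p q r s p' q' r' s' (nh : is_normal h p q r s)
    (nh' : is_normal h' p' q' r' s') : q * r = q' * r' -> p * s = p' * s' ->
    p ^+ n.+1 * q ^+ n.-1 = p' ^+ n.+1 * q' ^+ n.-1 ->
    r ^+ n.-1 * s ^+ n.+1 = r' ^+ n.-1 * s' ^+ n.+1 -> conjugate h h'.
  move=> e1 e2 eP eQ.
  have [P0|P0] := eqVneq (p ^+ n.+1 * q ^+ n.-1) 0; last exact: conj_of_leading nh nh' _ _ _ P0.
  have [Q0|Q0] := eqVneq (r ^+ n.-1 * s ^+ n.+1) 0.
    by apply: conj_of_degenerate nh nh' _ _ _ _ _ _ => //; rewrite -?eP -?eQ.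
  have [k [hk nk]] := normal_swap n0 nh; have [k' [hk' nk']] := normal_swap n0 nh'.
  apply: (conjugate_trans hk); apply: conjugate_trans (conjugate_sym hk').
  apply: conj_of_leading nk nk' _ _ _ _.
  - by rewrite mulrC e1 mulrC.
  - by rewrite mulrC e2 mulrC.
  - by rewrite mulrC eQ mulrC.
  - by rewrite mulrC.
move=> eY.
(* With determinant 1, bc = X and ad = 1+X. So P = a^(n+1)b^(n-1) and Q = c^(n-1)d^(n+1) have a
   known product as well as the known sum Y, and P is a root of (T-P')(T-Q'). *)
have /eqP : (a1 ^+ n.+1 * b1 ^+ n.-1 - a2 ^+ n.+1 * b2 ^+ n.-1) *
            (a1 ^+ n.+1 * b1 ^+ n.-1 - c2 ^+ n.-1 * d2 ^+ n.+1) = 0.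
  set P := a1 ^+ _ * _ in eY *; set Q := c1 ^+ _ * _ in eY.
  set P' := a2 ^+ _ * _ in eY *; set Q' := c2 ^+ _ * _ in eY *.
  have PQ : P * Q = P' * Q'.
    transitivity ((a1 * d1) ^+ n.+1 * (b1 * c1) ^+ n.-1); first by rewrite !exprMn /P /Q; ring.
    by rewrite ead ebc !exprMn /P' /Q'; ring.
  transitivity (P * (P + Q) - P * (P' + Q') - (P * Q - P' * Q')); first by ring.
  by rewrite eY PQ; ring.
rewrite mulf_eq0 !subr_eq0 => /orP[] /eqP eP.
  by apply: (same _ _ _ _ _ _ _ _ _ _ nf1 ng1) => //; move: eY; rewrite eP => /addrI.
(* The invariants agree crosswise, so the second map is replaced by its swapped normal form. *)
apply: conjugate_trans (conjugate_sym gg2).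
apply: (same _ _ _ _ _ _ _ _ _ _ nf1 ng2).
- by rewrite ebc mulrC.
- by rewrite ead mulrC.
- by rewrite eP mulrC.
- by move: eY; rewrite eP addrC => /addIr ->; rewrite mulrC.
Qed.

Lemma normal_surj (X Y : Cx R) : exists (f : ratmap R n) (a b c d : Cx R),
  [/\ is_normal f a b c d, normX a b c d = X & normY n a b c d = Y].
Proof.
suff [a [b [c [d [D1 eX eY]]]]] : exists a b c d : Cx R,
    [/\ a * d - b * c = 1, b * c = X & a ^+ n.+1 * b ^+ n.-1 + c ^+ n.-1 * d ^+ n.+1 = Y].
  have D0 : a * d - b * c != 0 by rewrite D1 oner_eq0.
  have [f [fn fd]] := normal_exists n0 D0; exists f, a, b, c, d.
  by split=> //; rewrite /normX /normY D1 ?expr1n divr1.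
have [X0|X0] := eqVneq X 0.
  exists 1, (n.-1.-root Y), 0, 1; split; rewrite ?X0 ?mulr0 ?subr0 ?mulr1 //.
  by rewrite expr1n mul1r rootCK // expr0n gtn_eqF // mul0r addr0.
(* Here a = 1 would give d = 0 and hence Y = b^(n-1), forcing b = 0 against bc = -1; a form with a =
   d = 0 is used instead. *)
have [[X1 Y0]|h] := pselect (X = -1 /\ Y = 0).
  exists 0, 1, (-1), 0; rewrite X1 Y0 !mul0r sub0r mul1r opprK; split=> //.
  by rewrite !expr0n /= mul0r mulr0 addr0.
(* Taking a = 1, c = X/b and d = 1+X, the condition on t = b^(n-1) becomes t + q/t = Y; a nonzero
   root of this quadratic is needed. *)
pose q := X ^+ n.-1 * (1 + X) ^+ n.+1.
have [t tE t0] : exists2 t, t ^+ 2 - Y * t + q = 0 & t != 0.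
  have [X1|X1] := eqVneq (1 + X) 0.
    exists Y; first by rewrite /q X1 expr0n /= mulr0 addr0 expr2 subrr.
    apply/eqP => Y0; apply: h; split=> //.
    by apply/eqP; rewrite -addr_eq0 addrC X1.
  pose e := sqrtC (Y ^+ 2 - 4 * q).
  have eE : e ^+ 2 = Y ^+ 2 - 4 * q by rewrite sqrtCK.
  have tE : ((Y + e) / 2) ^+ 2 - Y * ((Y + e) / 2) + q = 0.
    transitivity ((e ^+ 2 - (Y ^+ 2 - 4 * q)) / 4); first by field.
    by rewrite eE subrr mul0r.
  exists ((Y + e) / 2) => //; apply/eqP => t0; move/eqP: tE.
  rewrite t0 expr0n mulr0 subr0 add0r mulf_eq0 !expf_eq0 /=.
  by rewrite (negPf X0) (negPf X1) andbF.
have [b bE] : exists b : Cx R, b ^+ n.-1 = t by exists (n.-1.-root t); rewrite rootCK.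
have b0 : b != 0.
  by apply: contraNneq t0 => b0; rewrite -bE b0 expr0n gtn_eqF.
exists 1, b, (X / b), (1 + X); split; first by field.
  by field.
rewrite expr1n mul1r expr_div_n bE; apply: (mulfI t0).
transitivity (t ^+ 2 + q); first by rewrite /q; field.
by move/eqP: tE; rewrite addrAC subr_eq0 => /eqP ->; rewrite mulrC.
Qed.

End Classification.

(** * Moduli space *)

Section Moduli.
Variables (R : realType) (n : nat).
Hypothesis n_ge2 : (2 <= n)%N.
Implicit Types K : moduli R n.

Let class_of K : exists2 f, bicritical f & sval K = [set g | conjugate f g].
Proof. by have [f bf e] := set_mem (svalP K); exists f. Qed.

Lemma moduli_conj K f g : sval K f -> sval K g -> conjugate f g.
Proof.
have [h _ ->] := class_of K => /= hf hg.
exact: conjugate_trans (conjugate_sym hf) hg.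
Qed.

Lemma moduli_eq K K' f g : sval K f -> sval K' g -> conjugate f g -> K = K'.
Proof.
move=> Kf Kg fg; apply: val_inj => /=; have [h _ e] := class_of K.
have [h' _ e'] := class_of K'; move: Kf Kg; rewrite e e' /= => hf hg.
have hh' : conjugate h h'.
  exact: conjugate_trans (conjugate_trans hf fg) (conjugate_sym hg).
apply/seteqP; split=> k /= hk; first exact: conjugate_trans (conjugate_sym hh') hk.
exact: conjugate_trans hh' hk.
Qed.

Lemma moduli_normal K : exists f a b c d, sval K f /\ is_normal f a b c d.
Proof.
have [h bh ->] := class_of K.
by have [g [a [b [c [d [hg ng]]]]]] := bicritical_normal_form n_ge2 bh; exists g, a, b, c, d.
Qed.

(** Conjugacy invariance makes the set from which [xget] chooses a singleton. *)
Lemma modXE K f a b c d : sval K f -> is_normal f a b c d -> modX K = normX a b c d.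
Proof.
move=> Kf nf; apply: xget_subset1.
  by have [D0 fn fd] := nf; exists f, a, b, c, d; split.
move=> x y /= [g [a1 [b1 [c1 [d1 [Kg g1 g2 g3 ->]]]]]].
move=> [h [a2 [b2 [c2 [d2 [Kh h1 h2 h3 ->]]]]]].
have ng : is_normal g a1 b1 c1 d1 by [].
have nh : is_normal h a2 b2 c2 d2 by [].
exact: (normX_conj n_ge2 nh ng (moduli_conj Kh Kg)).
Qed.

Lemma mod_sigmaE k K f : sval K f -> mod_sigma k K = sigma k f.
Proof.
move=> Kf; apply: xget_subset1; first by exists f.
have e x : [set s | exists2 f, sval K f & s = sigma k f] x -> x = sigma k f.
  by move=> [g Kg ->]; exact: sigma_conj n_ge2 (moduli_conj Kf Kg).
by move=> x y /e -> /e ->.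
Qed.

Lemma moduli_inj K K' :
  modX K = modX K' -> mod_sigma n K = mod_sigma n K' -> K = K'.
Proof.
have [f [a [b [c [d [Kf nf]]]]]] := moduli_normal K.
have [g [a' [b' [c' [d' [Kg ng]]]]]] := moduli_normal K'.
rewrite (modXE Kf nf) (modXE Kg ng) (mod_sigmaE n Kf) (mod_sigmaE n Kg).
rewrite (sigma_normal n_ge2 nf) (sigma_normal n_ge2 ng) => eX.
rewrite /norm_sigma eX => eY; apply: moduli_eq Kf Kg _.
apply: (conj_of_invariants n_ge2 nf ng eX); apply: addIr (mulfI _ eY).
by rewrite expf_neq0 // pnatr_eq0 -lt0n (leq_trans _ n_ge2).
Qed.

Lemma moduli_surj (X s : Cx R) : exists K, modX K = X /\ mod_sigma n K = s.
Proof.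
have nn0 : n%:R ^+ n != 0 :> Cx R by rewrite expf_neq0 // pnatr_eq0 -lt0n (leq_trans _ n_ge2).
have [f [a [b [c [d [nf eX eY]]]]]] :=
  normal_surj n_ge2 X (s / n%:R ^+ n - (2 * X + 1 - n%:R) * X ^+ n.-1).
pose cl := [set [set g | conjugate f g] | f in @bicritical R n].
have bK : cl [set g | conjugate f g].
  by exists f => //; exact: bicritical_normal n_ge2 nf.
pose K : moduli R n := exist (fun x => x \in cl) _ (mem_set bK).
have Kf : sval K f by exact: conjugate_eval.
exists K; rewrite (modXE Kf nf) (mod_sigmaE n Kf) (sigma_normal n_ge2 nf) eX eY.
by split=> //; rewrite /norm_sigma subrK mulrC divfK.
Qed.

Lemma finite_chart_bij : set_bij (cdom (finite_chart R n)) setT (finite_chart R n).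
Proof.
split=> //; first by move=> [K|s] [K'|s'] /set_mem[? //] _ /set_mem[? //] _ [] eX es;
  congr inl; exact: moduli_inj.
by move=> [X s] _; have [K [eX es]] := moduli_surj X s; exists (inl K); [exists K|rewrite /= eX es].
Qed.

(** The line at infinity fills the points with first coordinate 0. Elsewhere X is nonzero, so
    n^(n+1) X^(n-1) can be divided out. *)
Lemma infinite_chart_bij : set_bij (cdom (infinite_chart R n)) setT (infinite_chart R n).
Proof.
have nn0 : n%:R ^+ n.+1 != 0 :> Cx R by rewrite expf_neq0 // pnatr_eq0 -lt0n (leq_trans _ n_ge2).
split=> // [x y /set_mem /= hx /set_mem /= hy|[X s] _]; last first.
  have [->|X0] := eqVneq X 0; first by exists (inr s).
  have [K [eX es]] := moduli_surj X^-1 (s * (n%:R ^+ n.+1 * X^-1 ^+ n.-1)).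
  exists (inl K); first by rewrite /= eX; apply/eqP; rewrite invr_eq0.
  rewrite /= eX es invrK mulfK // mulf_neq0 // expf_neq0 //.
  by rewrite invr_eq0.
case: x y hx hy => [K|s] [K'|s'] h h' /=; last by case=> ->.
- case=> /invr_inj eX es; congr inl; apply: moduli_inj => //.
  have k0 : (n%:R ^+ n.+1 * modX K' ^+ n.-1)^-1 != 0.
    by rewrite invr_eq0 mulf_neq0 // expf_neq0 //; apply/eqP.
  by move: es; rewrite eX; exact: mulIf.
- by case=> /eqP; rewrite invr_eq0 => /eqP.
- by case=> /esym/eqP; rewrite invr_eq0 => /eqP.
Qed.

End Moduli.

(** * Charted manifolds and fibred atlases *)

Lemma continuous_fst (T U : topologicalType) : continuous (fst : T * U -> T).
Proof. by case=> a b; exact: cvg_fst. Qed.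

Lemma continuous_snd (T U : topologicalType) : continuous (snd : T * U -> U).
Proof. by case=> a b; exact: cvg_snd. Qed.

Lemma differentiable_fst (K : numFieldType) (E F : normedModType K) (x : E * F) :
  differentiable (fst : E * F -> E) x.
Proof.
have lin : linear (fst : E * F -> E) by [].
pose M := GRing.isLinear.Build _ _ _ _ _ lin.
pose L : {linear (E * F)%type -> E} := HB.pack (fst : E * F -> E) M.
exact: (@linear_differentiable _ _ _ L x (@continuous_fst E F)).
Qed.

Lemma differentiable_snd (K : numFieldType) (E F : normedModType K) (x : E * F) :
  differentiable (snd : E * F -> F) x.
Proof.
have lin : linear (snd : E * F -> F) by [].
pose M := GRing.isLinear.Build _ _ _ _ _ lin.
pose L : {linear (E * F)%type -> F} := HB.pack (snd : E * F -> F) M.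
exact: (@linear_differentiable _ _ _ L x (@continuous_snd E F)).
Qed.

Section HolomorphicWrt.
Variable K : numFieldType.

Lemma holomorphic_wrt_refl (E : normedModType K) (T : Type) (D : set T) (f : T -> E) :
  holomorphic_wrt D f f.
Proof. by exists id => x _. Qed.

Lemma holomorphic_wrt_trans (E E' E'' : normedModType K) (T : Type) (D : set T)
    (f : T -> E) (g : T -> E') (h : T -> E'') :
  holomorphic_wrt D f g -> holomorphic_wrt D g h -> holomorphic_wrt D f h.
Proof.
move=> [u uE] [v vE]; exists (v \o u) => x Dx.
have [du eu] := uE x Dx; have [dv ev] := vE x Dx.
by split; [apply: differentiable_comp => //; rewrite eu|rewrite /= eu].
Qed.

Lemma holomorphic_wrt_comp (E E' : normedModType K) (T U : Type) (D : set T)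
    (D' : set U) (f : T -> E) (g : T -> E') (k : U -> T) :
  holomorphic_wrt D f g -> (forall x, D' x -> D (k x)) ->
  holomorphic_wrt D' (f \o k) (g \o k).
Proof. by move=> [u uE] h; exists u => x /h /uE. Qed.

Lemma holomorphic_wrt_eq (E E' : normedModType K) (T : Type) (D D' : set T)
    (f f' : T -> E) (g g' : T -> E') :
  holomorphic_wrt D f g -> D' `<=` D -> (forall x, D' x -> f x = f' x) ->
  (forall x, D' x -> g x = g' x) -> holomorphic_wrt D' f' g'.
Proof.
move=> [u uE] h ef eg; exists u => x D'x; have := uE x (h x D'x).
by rewrite ef // eg.
Qed.

Lemma holomorphic_wrt_pair (E E' E'' : normedModType K) (T : Type) (D : set T)
    (f : T -> E) (g : T -> E') (h : T -> E'') :
  holomorphic_wrt D f g -> holomorphic_wrt D f h ->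
  holomorphic_wrt D f (fun x => (g x, h x)).
Proof.
move=> [u uE] [v vE]; exists (fun y => (u y, v y)) => x Dx.
have [du <-] := uE x Dx; have [dv <-] := vE x Dx.
by split=> //; exact: differentiable_pair.
Qed.

Lemma holomorphic_wrt_fst (E E' : normedModType K) (T : Type) (D : set T)
  (f : T -> E * E') : holomorphic_wrt D f (fun x => (f x).1).
Proof. by exists fst => x _; split=> //; exact: differentiable_fst. Qed.

Lemma holomorphic_wrt_snd (E E' : normedModType K) (T : Type) (D : set T)
  (f : T -> E * E') : holomorphic_wrt D f (fun x => (f x).2).
Proof. by exists snd => x _; split=> //; exact: differentiable_snd. Qed.

Lemma holomorphic_wrt_cst (E E' : normedModType K) (T : Type) (D : set T)
  (f : T -> E) (a : E') : holomorphic_wrt D f (fun=> a).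
Proof. by exists (fun=> a) => x _; split=> //; exact: differentiable_cst. Qed.

End HolomorphicWrt.

Lemma charted_openE (E : topologicalType) (T : Type) (A : atlas E T) (V : set (charted A)) :
  open V = atlas_open A V.
Proof. by []. Qed.

(** * Manifolds whose charts are bijections onto the model space *)

Section ChartedManifold.
Variables (K : numFieldType) (E : normedModType K) (T : Type) (A : atlas E T).
Hypothesis cover : forall x, exists2 c, A c & cdom c x.
Hypothesis bij : forall c, A c -> set_bij (cdom c) setT c.
Hypothesis transition_open : forall c d, A c -> A d -> open (c @` (cdom c `&` cdom d)).
Hypothesis transition_hol : forall c d, A c -> A d ->
  holomorphic_wrt (cdom c `&` cdom d) c d.

(** Read in another chart [d], the set is the preimage of [W] under the transition map, which is
    continuous on the open image of the overlap. *)
Lemma charted_open_preimage c W : A c -> open W ->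
  open (cdom c `&` c @^-1` W : set (charted A)).
Proof.
move=> Ac oW; rewrite charted_openE => d Ad; have [g gE] := transition_hol Ad Ac.
pose O := d @` (cdom d `&` cdom c).
exists (O `&` g @^-1` W).
  have gO : {in O, continuous g}.
    move=> y /set_mem[x xdc <-]; apply: differentiable_continuous.
    by have [] := gE x xdc.
  exact: (continuous_inP g (transition_open Ad Ac)).1 gO W oW.
have [_ inj _] := bij Ad.
apply/seteqP; split=> x /= [dx].
  move=> [cx Wx]; split=> //; have [_ e] := gE x (conj dx cx).
  by split; [exists x|rewrite /preimage /= e].
move=> [[y [dy cy] eyx] gx]; have exy : y = x by apply: inj => //; exact: mem_set.
rewrite exy in cy; split=> //; split=> //; have [_ e] := gE x (conj dx cy).
by rewrite /preimage /= -e.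
Qed.

Lemma charted_manifold : complex_manifold (T := charted A) A.
Proof.
have odom c : A c -> open (cdom c : set (charted A)).
  by move=> Ac; have := charted_open_preimage Ac openT; rewrite preimage_setT setIT.
split=> //.
- by move=> c Ac; have [] := bij Ac.
- move=> c Ac; rewrite (continuous_open_subspace _ (odom c Ac)).
  apply/(continuous_inP _ (odom c Ac)) => W oW; exact: charted_open_preimage.
- move=> c Ac V Vc oV; move: oV; rewrite charted_openE => /(_ c Ac)[W oW e]; have [_ _ surj] := bij Ac.
  (* Because [c] is onto, the open set whose trace is [V] is exactly its image. *)
  suff -> : c @` V = W by [].
  apply/seteqP; split=> [_ [x Vx <-]|w Ww].
    have : (cdom c `&` V) x by split=> //; exact: Vc.
    by rewrite e => -[].
  have [x cx xw] := surj w I; exists x => //.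
  have : (cdom c `&` c @^-1` W) x by split=> //; rewrite /preimage /= xw.
  by rewrite -e => -[].
Qed.

End ChartedManifold.

(** * Atlases whose charts lie over those of the base, with [p] as first coordinate *)

Section FibredAtlas.
Variables (K : numFieldType) (E F : normedModType K) (T S : topologicalType).
Variables (A : atlas (E * F) T) (B : atlas E S) (p : T -> S).
Variables (J : Type) (c : J -> chart (E * F) T) (b : J -> chart E S).
Hypotheses (MA : complex_manifold A) (MB : complex_manifold B).
Hypothesis AE : forall e, A e <-> exists i, e = c i.
Hypothesis BE : forall e, B e <-> exists i, e = b i.
Hypothesis domE : forall i x, cdom (c i) x <-> cdom (b i) (p x).
Hypothesis fstE : forall i x, cdom (c i) x -> b i (p x) = (c i x).1.
Hypothesis bij : forall i, set_bij (cdom (c i)) setT (c i).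

Let Ac i : A (c i). Proof. by apply/AE; exists i. Qed.
Let Bb i : B (b i). Proof. by apply/BE; exists i. Qed.

Let odomA i : open (cdom (c i)). Proof. exact: (chart_dom_open MA). Qed.
Let odomB i : open (cdom (b i)). Proof. exact: (chart_dom_open MB). Qed.

Let continuousA i x : cdom (c i) x -> {for x, continuous (c i)}.
Proof.
move=> cx; have := chart_continuous MA (Ac i).
by rewrite (continuous_open_subspace _ (odomA i)); apply; exact: mem_set.
Qed.

Let continuousB i x : cdom (b i) x -> {for x, continuous (b i)}.
Proof.
move=> bx; have := chart_continuous MB (Bb i).
by rewrite (continuous_open_subspace _ (odomB i)); apply; exact: mem_set.
Qed.

Let inverse i : exists e : E * F -> T, forall v, cdom (c i) (e v) /\ c i (e v) = v.
Proof.
have /choice[e eP] : forall v, exists x, cdom (c i) x /\ c i x = v.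
  by move=> v; have [_ _ surj] := bij i; have [x cx xv] := surj v I; exists x.
by exists e.
Qed.

Let inverseK i e : (forall v, cdom (c i) (e v) /\ c i (e v) = v) ->
  forall x, cdom (c i) x -> e (c i x) = x.
Proof.
move=> eP x cx; have [ce ee] := eP (c i x).
by apply: (chart_inj MA (Ac i)) => //; exact: mem_set.
Qed.

Let continuous_inverse i e : (forall v, cdom (c i) (e v) /\ c i (e v) = v) ->
  continuous e.
Proof.
move=> eP; apply/continuousP => V oV.
have := chart_open MA (Ac i) (@subIsetl _ (cdom (c i)) V) (openI (odomA i) oV).
suff -> : c i @` (cdom (c i) `&` V) = e @^-1` V by [].
apply/seteqP; split=> [_ [x [cx Vx] <-]|v Vv]; first by rewrite /preimage /= inverseK.
by have [ce ee] := eP v; exists (e v).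
Qed.

Let continuousp : continuous p.
Proof.
apply/continuousP => V oV; rewrite openE => x Vx.
have [e] := chart_cover MA x; move=> /AE[i ->] cx.
(* In charts [p] is the first projection, so the preimage is detected by the first coordinate lying
   in this open set. *)
have oO : open (b i @` (cdom (b i) `&` V)).
  by apply: (chart_open MB (Bb i)); [exact: subIsetl|exact: openI].
have nO : nbhs x (fun y => (b i @` (cdom (b i) `&` V)) (c i y).1).
  have h : {for x, continuous (fst \o c i)}.
    by apply: continuous_comp; [exact: continuousA|exact: continuous_fst].
  apply: h; apply: open_nbhs_nbhs; split=> //=.
  by exists (p x); [split=> //; exact/domE|exact: fstE].
have nC : nbhs x (cdom (c i)) by apply: open_nbhs_nbhs; split.
apply: filterS2 nO nC => y [s [bs Vs] sy] cy.
rewrite /preimage /= -(_ : s = p y) //; apply: (chart_inj MB (Bb i)).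
- exact: mem_set.
- by apply/mem_set/domE.
- by rewrite sy fstE.
Qed.

Let transA i j : holomorphic_wrt (cdom (c i) `&` cdom (c j)) (c i) (c j).
Proof. exact: (chart_compatible MA). Qed.

Let within_continuous (X Y : topologicalType) (D : set X) (f : X -> Y) : open D ->
  (forall x, D x -> {for x, continuous f}) -> {within D, continuous f}.
Proof. by move=> oD h; rewrite continuous_open_subspace // => x /set_mem; exact: h. Qed.

Lemma fibred_holomorphic : holomorphic_on A B setT p.
Proof.
split; first exact: openT.
  by apply: within_continuous => [|x _]; [exact: openT|exact: continuousp].
move=> _ _ /AE[i ->] /BE[j ->].
apply: (holomorphic_wrt_eq (holomorphic_wrt_trans (transA i j) (holomorphic_wrt_fst _ (c j)))) => //.
  by move=> x [[_ cx] /domE cx'].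
by move=> x [_ /domE cx] /=; rewrite fstE.
Qed.

Let exists_base s : exists i, cdom (b i) s.
Proof. by have [_ /BE[i ->]] := chart_cover MB s; exists i. Qed.

Let transInv i j e : (forall v, cdom (c i) (e v) /\ c i (e v) = v) ->
  holomorphic_wrt (fun v => cdom (c j) (e v)) id (c j \o e).
Proof.
move=> eP; apply: (holomorphic_wrt_eq (holomorphic_wrt_comp (k := e)
  (D' := fun v => cdom (c j) (e v)) (transA i j) _)) => //.
- by move=> v cv; split=> //; have [] := eP v.
- by move=> v _ /=; have [] := eP v.
Qed.

Lemma fibred_locally_trivial : locally_trivial A B (model_atlas F) p.
Proof.
move=> s; have [i bs] := exists_base s; exists (cdom (b i)); split=> //.
have [e eP] := inverse i; have eK := inverseK eP; have ce := continuous_inverse eP.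
have domU : p @^-1` cdom (b i) = cdom (c i) by apply/seteqP; split=> x /domE.
(* Over one base chart the fibre coordinate is the second component of [c i], and the global inverse
   [e] of that chart rebuilds the point. *)
exists (fun x => (p x, (c i x).2)), (fun y => e (b i y.1, y.2)); split.
- rewrite domU; split=> //.
    apply: within_continuous => // x cx; apply: cvg_pair; first exact: continuousp.
    by apply: continuous_comp; [exact: continuousA|exact: continuous_snd].
  move=> _ _ /AE[j ->] [_ [d [/BE[k ->] -> ->]]].
  (* Writing the base coordinate as (c k x).1 leaves only transitions between charts of [A]. *)
  apply: (holomorphic_wrt_eq (D := cdom (c i) `&` cdom (c j) `&` cdom (c k))
    (f := c j) (g := fun x => ((c k x).1, (c i x).2))) => //.
  + apply: holomorphic_wrt_pair.
      apply: holomorphic_wrt_trans (holomorphic_wrt_fst _ (c k)).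
      by apply: (holomorphic_wrt_eq (transA j k)) => // x [[]].
    apply: holomorphic_wrt_trans (holomorphic_wrt_snd _ (c i)).
    by apply: (holomorphic_wrt_eq (transA j i)) => // x [[]].
  + by move=> x [[ci cj] [/domE ck _]].
  + by move=> x [_ [/domE ck _]] /=; rewrite fstE.
- have oU : open (cdom (b i) `*` [set: F]).
    have -> : cdom (b i) `*` [set: F] = fst @^-1` cdom (b i) by apply/seteqP; split=> x // [].
    by move/continuousP: (@continuous_fst S F); apply.
  split=> //.
    apply: within_continuous => // -[x y] [bx _].
    apply: (continuous_comp (f := fun z : S * F => (b i z.1, z.2))); last exact: ce.
    apply: (@cvg_pair _ _ _ _ (nbhs (b i x)) (nbhs y)); last exact: (@continuous_snd S F (x, y)).
    by apply: (continuous_comp (f := fst)); [exact: continuous_fst|exact: continuousB].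
  move=> _ _ [_ [d [/BE[j ->] -> ->]]] /AE[k ->].
  have h1 : holomorphic_wrt (cdom (b i) `*` setT `&` cdom (b j) `*` setT : set (S * F))
      (prod_chart (b j) (Chart setT id)) (fun y => (b i y.1, y.2)).
    apply: holomorphic_wrt_pair; last exact: (holomorphic_wrt_snd _ (prod_chart (b j) (Chart setT id))).
    apply: holomorphic_wrt_trans (holomorphic_wrt_fst _ (prod_chart (b j) (Chart setT id))) _.
    apply: (holomorphic_wrt_comp (k := fst)
      (chart_compatible MB (Bb j) (Bb i))).
    by move=> y [[bi _] [bj _]].
  apply: (holomorphic_wrt_trans (g := fun y => (b i y.1, y.2))).
    by apply: (holomorphic_wrt_eq h1) => // y [[[bi _] bj] _].
  apply: (holomorphic_wrt_eq (holomorphic_wrt_comp (k := fun y => (b i y.1, y.2))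
    (D' := fun y : S * F => cdom (c k) (e (b i y.1, y.2))) (transInv k eP) _)) => //.
- by move=> x /domE cx /=; split=> //; rewrite fstE // -surjective_pairing eK.
- move=> [y t] /= by'; have [cv ev] := eP (b i y, t).
  have py : p (e (b i y, t)) = y.
    apply: (chart_inj MB (Bb i)); [exact/mem_set/domE|exact: mem_set|].
    by rewrite fstE // ev.
  by rewrite py ev.
Qed.

Lemma fibred_fibre s : sub_biholomorphic A (model_atlas F) (p @^-1` [set s]).
Proof.
have [i bs] := exists_base s.
have [e eP] := inverse i; have eK := inverseK eP; have ce := continuous_inverse eP.
(* The fibre is the slice of the chart with first coordinate b i s. The second coordinate, defined
   on the whole chart domain, is the ambient extension of the inverse. *)
exists (fun t => e (b i s, t)), (fun x => (c i x).2); split.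
- split; first exact: openT.
    apply: within_continuous => [|t _]; first exact: openT.
    apply: continuous_comp; last exact: ce.
    by apply: cvg_pair; [exact: cvg_cst|exact: cvg_id].
  move=> _ _ -> /AE[k ->].
  apply: (holomorphic_wrt_trans (g := fun t => (b i s, t))).
    apply: holomorphic_wrt_pair; first exact: holomorphic_wrt_cst.
    exact: holomorphic_wrt_refl.
  apply: (holomorphic_wrt_eq (holomorphic_wrt_comp (k := fun t => (b i s, t))
    (D' := fun t => cdom (c k) (e (b i s, t))) (transInv k eP) _)) => //.
- apply/seteqP; split=> [_ [t _ <-]|x xs] /=.
    have [cv ev] := eP (b i s, t).
    apply: (chart_inj MB (Bb i)); [exact/mem_set/domE|exact: mem_set|].
    by rewrite fstE // ev.
  have cx : cdom (c i) x by apply/domE; rewrite xs.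
  by exists (c i x).2 => //; rewrite -xs fstE // -surjective_pairing eK.
- move=> x xs; exists (cdom (c i)), (fun x => (c i x).2); split=> //.
    by apply/domE; rewrite xs.
  split=> //.
    apply: within_continuous => // y cy.
    by apply: continuous_comp; [exact: continuousA|exact: continuous_snd].
  move=> _ _ /AE[j ->] ->.
  apply: (holomorphic_wrt_trans _ (holomorphic_wrt_snd _ (c i))).
  by apply: (holomorphic_wrt_eq (transA j i)) => // y [[]].
- by move=> t /=; have [_ ->] := eP (b i s, t).
Qed.

End FibredAtlas.

(** * The sphere and the extended moduli space *)

Definition separated (T : topologicalType) (x y : T) := exists U V : set T,
  [/\ open U, open V, U x, V y & U `&` V = set0].

Lemma separated_sym (T : topologicalType) (x y : T) : separated x y -> separated y x.
Proof. by move=> [U [V [oU oV Ux Vy UV]]]; exists V, U; split=> //; rewrite setIC. Qed.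

Lemma hausdorff_separated (T : topologicalType) :
  hausdorff_space T <-> forall x y : T, x <> y -> separated x y.
Proof.
rewrite open_hausdorff; split=> h x y.
  move=> /eqP /h[[U V] /= [/set_mem Ux /set_mem Vy] [oU oV /eqP UV]].
  by exists U, V.
move=> /eqP /h[U [V [oU oV Ux Vy UV]]]; exists (U, V) => /=.
  by split; exact: mem_set.
by split=> //; apply/eqP.
Qed.

Lemma chart_preimage_open (K : numFieldType) (E : normedModType K) (T : topologicalType)
    (A : atlas E T) c W : complex_manifold A -> A c -> open W -> open (cdom c `&` c @^-1` W).
Proof.
move=> MA Ac; have oc := chart_dom_open MA Ac; have := chart_continuous MA Ac.
by rewrite (continuous_open_subspace _ oc) => /(continuous_inP _ oc); exact.
Qed.

Lemma chart_separated (K : numFieldType) (E : normedModType K) (T : topologicalType)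
    (A : atlas E T) c x y : complex_manifold A -> A c -> cdom c x -> cdom c y ->
  x <> y -> separated x y.
Proof.
move=> MA Ac cx cy xy.
have /hausdorff_separated/(_ (c x) (c y))[] : hausdorff_space E by exact: norm_hausdorff.
  by move=> e; apply: xy; apply: (chart_inj MA Ac) => //; exact: mem_set.
move=> U [V [oU oV Ux Vy UV]].
exists (cdom c `&` c @^-1` U), (cdom c `&` c @^-1` V).
split=> //; [exact: (chart_preimage_open MA Ac oU)|exact: (chart_preimage_open MA Ac oV)|].
by rewrite setIACA setIid -preimage_setI UV preimage_set0 setI0.
Qed.

Lemma open_neq0 (K : numFieldType) : open [set w : K | w != 0].
Proof.
rewrite openE => w w0.
have cw : id x @[x --> w] --> (w : K^o) by exact: cvg_id.
exact: (@cvgr_neq0 K K^o _ _ _ id _ cw w0).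
Qed.

Lemma two_chart_manifold (K : numFieldType) (E : normedModType K) (T : Type)
    (A : atlas E T) (c : bool -> chart E T) :
  (forall e, A e <-> exists i, e = c i) ->
  (forall x, exists i, cdom (c i) x) ->
  (forall i, set_bij (cdom (c i)) setT (c i)) ->
  (forall i, open (c i @` (cdom (c i) `&` cdom (c (~~ i))))) ->
  (forall i, holomorphic_wrt (cdom (c i) `&` cdom (c (~~ i))) (c i) (c (~~ i))) ->
  complex_manifold (T := charted A) A.
Proof.
move=> AE cover bij otrans htrans; apply: charted_manifold.
- by move=> x; have [i cx] := cover x; exists (c i) => //; apply/AE; exists i.
- by move=> _ /AE[i ->].
- move=> _ _ /AE[i ->] /AE[j ->].
  have [->|ij] := eqVneq j i; last by have -> : j = ~~ i by case: i j ij => -[].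
  have [_ _ surj] := bij i; rewrite setIid.
  suff -> : c i @` cdom (c i) = setT by exact: openT.
  by apply/seteqP; split=> // w /surj.
- move=> _ _ /AE[i ->] /AE[j ->].
  have [->|ij] := eqVneq j i; first exact: holomorphic_wrt_refl.
  by have -> : j = ~~ i by case: i j ij => -[].
Qed.

Section Sphere.
Variable R : realType.
Local Notation C := (Cx R).

Definition sphere_chart (i : bool) : chart C (sphere_pt R) :=
  if i then Chart [set x | x <> None] (local_coord (Some 0))
  else Chart [set x | x <> Some 0] (local_coord None).

Lemma sphere_atlasE e : sphere_atlas R e <-> exists i, e = sphere_chart i.
Proof.
split=> [[->|->]|[[] ->]]; [by exists true|by exists false|by left|by right].
Qed.

Lemma sphere_manifold : complex_manifold (T := sphere R) (sphere_atlas R).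
Proof.
apply: (two_chart_manifold sphere_atlasE).
- by move=> [z|]; [exists true|exists false].
- case; split=> //.
  + by move=> [z|] [w|] /set_mem h /set_mem h' //= ->.
  + by move=> w _; exists (Some w).
  + move=> [z|] [w|] /set_mem /= h /set_mem /= h' //.
    * by move/invr_inj => ->.
    * by move=> /eqP; rewrite invr_eq0 => /eqP z0; rewrite z0 in h.
    * by move=> /esym/eqP; rewrite invr_eq0 => /eqP z0; rewrite z0 in h'.
  + move=> w _; have [->|w0] := eqVneq w 0; first by exists None.
    exists (Some w^-1); last by rewrite /= invrK.
    by case=> /eqP; rewrite invr_eq0 (negPf w0).
- move=> i; suff -> : sphere_chart i @` (cdom (sphere_chart i) `&` cdom (sphere_chart (~~ i))) =
    [set w | w != 0] by exact: open_neq0.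
  apply/seteqP; case: i => /=; split=> [_ [[z|] [h1 h2] <-] //=|w /= w0].
  + by apply: contra_notN h2 => /eqP ->.
  + by exists (Some w) => //; split=> // -[] /eqP; rewrite (negPf w0).
  + by rewrite invr_eq0; apply: contra_notN h1 => /eqP ->.
  + exists (Some w^-1); last by rewrite /= invrK.
    by split=> // -[] /eqP; rewrite invr_eq0 (negPf w0).
- have dinv (w : C) : w != 0 -> differentiable (GRing.inv : C -> C) w.
    exact: differentiable_Rinv.
  case; exists GRing.inv => x [h1 h2]; split.
  + apply: dinv; case: x h1 h2 => [z|] h1 h2; last by case: h1.
    by rewrite /=; apply: contra_notN h2 => /eqP ->.
  + by case: x h1 h2.
  + apply: dinv; case: x h1 h2 => [z|] h1 h2; last by case: h2.
    by rewrite /= invr_eq0; apply: contra_notN h1 => /eqP ->.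
  + by case: x h1 h2 => [z|] h1 h2; [rewrite /= invrK|case: h2].
Qed.

Lemma sphere_separated (x y : sphere R) : x <> y -> separated x y.
Proof.
(* The only pair without a common chart. The discs |z| < 1 and |1/z| < 1 separate it, since |z| and
   |1/z| multiply to 1. *)
have inf0 : separated (None : sphere R) (Some 0 : sphere R).
  pose U i : set (sphere R) := cdom (sphere_chart i) `&` sphere_chart i @^-1` ball (0 : C) 1.
  have oU i : open (U i).
    apply: (chart_preimage_open sphere_manifold); last exact: ball_open.
    by apply/sphere_atlasE; exists i.
  exists (U false), (U true); split=> //.
  - by split=> //=; exact: ballxx.
  - by split=> //=; exact: ballxx.
  - apply/seteqP; split=> // -[z|] [[h1 h2] [h3 h4]] //; move: h2 h4.
    rewrite /preimage /= -!ball_normE /= !sub0r !normrN normfV => lt1 lt2.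
    have z0 : z != 0 by apply: contra_notN h1 => /eqP ->.
    have := mulr_ilt1 (normr_ge0 z) (_ : 0 <= `|z|^-1) lt2 lt1.
    by rewrite invr_ge0 normr_ge0 mulfV ?normr_eq0 // ltxx => /(_ isT).
have same i : cdom (sphere_chart i) x -> cdom (sphere_chart i) y -> x <> y -> separated x y.
  by apply: (chart_separated sphere_manifold); apply/sphere_atlasE; exists i.
case: x y same => [z|] [w|] same xy //.
- by apply: (same true).
- have [z0|z0] := eqVneq z 0; first by rewrite z0; exact: separated_sym.
  by apply: (same false) => //= -[] /eqP; rewrite (negPf z0).
- have [w0|w0] := eqVneq w 0; first by rewrite w0.
  by apply: (same false) => //= -[] /eqP; rewrite (negPf w0).
Qed.

End Sphere.

(** * The extended moduli space over the sphere *)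

Section ExtendedModuli.
Variables (R : realType) (n : nat).
Hypothesis n_ge2 : (2 <= n)%N.
Local Notation C := (Cx R).

Definition ext_chart (i : bool) : chart (C * C) (ext_moduli_pt R n) :=
  if i then finite_chart R n else infinite_chart R n.

Lemma ext_atlasE e : ext_atlas R n e <-> exists i, e = ext_chart i.
Proof.
split=> [[->|->]|[[] ->]]; [by exists true|by exists false|by left|by right].
Qed.

Lemma ext_chart_bij i : set_bij (cdom (ext_chart i)) setT (ext_chart i).
Proof. by case: i; [exact: finite_chart_bij|exact: infinite_chart_bij]. Qed.

(** Both transition maps have this form with m = n-1, one with k = n^(-n-1) and the other with k =
    n^(n+1). *)
Lemma differentiable_transition (K : numFieldType) (k : K) m (v : K * K) : v.1 != 0 ->
  differentiable (fun v : K * K => (v.1^-1, v.2 * (k * v.1^-1 ^+ m))) v.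
Proof.
move=> v0.
have dV : differentiable (fun v : K * K => v.1^-1) v.
  by apply: differentiableV => //; exact: differentiable_fst.
apply: differentiable_pair => //; apply: differentiableM; first exact: differentiable_snd.
apply: differentiableM; first exact: differentiable_cst.
elim: m => [|m IH]; first exact: differentiable_cst.
have -> : (fun v : K * K => v.1^-1 ^+ m.+1) = (fun v => v.1^-1) * (fun v => v.1^-1 ^+ m).
  by apply/funext => w; rewrite exprS.
exact: differentiableM.
Qed.

Lemma ext_manifold : complex_manifold (T := ext_moduli R n) (ext_atlas R n).
Proof.
pose N : C := n%:R ^+ n.+1.
have N0 : N != 0 by rewrite expf_neq0 // pnatr_eq0 -lt0n (leq_trans _ n_ge2).
apply: (two_chart_manifold ext_atlasE).
- by move=> [K|s]; [exists true; exists K|exists false].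
- exact: ext_chart_bij.
- move=> i; have -> : ext_chart i @` (cdom (ext_chart i) `&` cdom (ext_chart (~~ i))) =
      fst @^-1` [set w | w != 0].
    apply/seteqP; split=> [_ [x [h1 h2] <-]|v v0].
      case: i h1 h2 => /=; first by move=> [K ->] /= h; exact/eqP.
      by move=> h [K e]; move: h; rewrite e /= invr_eq0 => h; exact/eqP.
    have [_ _ surj] := ext_chart_bij i; have [x cx xv] := surj v I.
    exists x => //; split=> //; move: v0; rewrite -xv; case: i cx {xv surj} => /=.
      by move=> [K ->] /= /eqP.
    by case: x => [K|s] /= h; [exists K|rewrite eqxx].
  by move/continuousP: (@continuous_fst C C); apply; exact: open_neq0.
- case.
    exists (fun v => (v.1^-1, v.2 * (N^-1 * v.1^-1 ^+ n.-1))) => x [[K ->] h]; split.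
      by apply: differentiable_transition; exact/eqP.
    by rewrite /= invfM exprVn.
  exists (fun v => (v.1^-1, v.2 * (N * v.1^-1 ^+ n.-1))) => x [h [K e]].
  rewrite e in h *; split.
    by apply: differentiable_transition; rewrite /= invr_eq0; exact/eqP.
  rewrite /= !invrK divfK // mulf_neq0 // expf_neq0 //; exact/eqP.
Qed.

Lemma ext_domE i (x : ext_moduli R n) :
  cdom (ext_chart i) x <-> cdom (sphere_chart R i) (extX R n x).
Proof.
case: i x => -[K|s] /=; split=> //.
- by exists K.
- by case.
- by move=> h [].
- by move=> h e; apply: h; rewrite e.
Qed.

Lemma ext_fstE i (x : ext_moduli R n) : cdom (ext_chart i) x ->
  sphere_chart R i (extX R n x) = (ext_chart i x).1.
Proof. by case: i x => -[K|s] //= [K']. Qed.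

(** Points with different values of X are separated by preimages of open sets of the sphere; points
    with the same value lie in a common chart. *)
Lemma ext_hausdorff : hausdorff_space (ext_moduli R n).
Proof.
apply/hausdorff_separated => x y xy.
have [_ contX _] := fibred_holomorphic ext_manifold (sphere_manifold R) ext_atlasE
  (@sphere_atlasE R) ext_domE ext_fstE.
have [eX|/sphere_separated] := pselect (extX R n x = extX R n y).
  have [e /sphere_atlasE[i ->] ex] := chart_cover (sphere_manifold R) (extX R n x).
  apply: (@chart_separated C _ (ext_moduli R n) (ext_atlas R n) (ext_chart i) _ _ ext_manifold) => //.
  - by apply/ext_atlasE; exists i.
  - exact/ext_domE.
  - by apply/ext_domE; rewrite -eX.
move=> [U [V [oU oV Ux Vy UV]]]; exists (extX R n @^-1` U), (extX R n @^-1` V).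
move: contX; rewrite (continuous_open_subspace _ openT) => /(continuous_inP _ openT) cX.
split=> //; [rewrite -[_ @^-1` _]setTI; exact: cX|rewrite -[_ @^-1` _]setTI; exact: cX|].
by rewrite -preimage_setI UV preimage_set0.
Qed.

End ExtendedModuli.

Theorem lemma6p2 (R : realType) (n : nat) (n_ge2 : (2 <= n)%N) :
  [/\ (forall c, ext_atlas R n c -> set_bij (cdom c) [set: Cx R * Cx R] c),
      complex_manifold (T := ext_moduli R n) (ext_atlas R n),
      hausdorff_space (ext_moduli R n) &
      [/\ holomorphic_on (T := ext_moduli R n) (T' := sphere R)
            (ext_atlas R n) (sphere_atlas R) setT (extX R n),
          locally_trivial (T := ext_moduli R n) (T' := sphere R) (F := Cx R)
            (ext_atlas R n) (sphere_atlas R) (model_atlas (Cx R)) (extX R n) &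
          forall X0 : sphere R,
            sub_biholomorphic (T := ext_moduli R n) (T' := Cx R)
              (ext_atlas R n) (model_atlas (Cx R)) (extX R n @^-1` [set X0])]].
Proof.
have MA := @ext_manifold R n n_ge2; have MB := sphere_manifold R.
have AE := @ext_atlasE R n; have BE := @sphere_atlasE R.
have dE := @ext_domE R n; have fE := @ext_fstE R n.
have cb := @ext_chart_bij R n n_ge2.
split=> //.
- by move=> _ /AE[i ->].
- exact: (@ext_hausdorff R n n_ge2).
split.
- exact: (fibred_holomorphic MA MB AE BE dE fE).
- exact: (fibred_locally_trivial MA MB AE BE dE fE cb).
- exact: (fibred_fibre MA MB AE BE dE fE cb).
Qed.
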